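(* Consider the linear parameter-varying system $$\dot{x}(t)=A(\theta(t))x(t)+Bd(t),\quad t\ge 0, \qquad (\mathrm{S})$$ with state $x(t)\in\mathbb{R}^n$, scheduling parameter $\theta(t)\in\Pi\subset\mathbb{R}^r$, $\theta\in\mathcal{L}_\infty^r$, input $d:\mathbb{R}_+\to\mathbb{R}^m$, matrix $B\in\mathbb{R}^{n\times m}$, and a locally bounded (continuous) matrix function $A:\Pi\to\mathbb{R}^{n\times n}$. Assume: (A1) $x\in\mathcal{L}_\infty^n$, and $\underline{x}_0\le x(0)\le\overline{x}_0$ for some given $\underline{x}_0,\overline{x}_0\in\mathbb{R}^n$. (A2) There are signals $\underline{d},\overline{d}\in\mathcal{L}_\infty^m$ such that $\underline{d}(t)\le d(t)\le\overline{d}(t)$ for all $t\ge0$. (A3) There exist a Metzler matrix $A_0\in\mathbb{R}^{n\times n}$, an integer $N\geq 1$, matrices $\Delta A_i\in\mathbb{R}^{n\times n}$ and functions $\lambda_i:\Pi\to[0,1]$, $i=1,\dots,N$, such that for all $\theta\in\Pi$ $$A(\theta)=A_0+\sum_{i=1}^N\lambda_i(\theta)\Delta A_i,\qquad \sum_{i=1}^N\lambda_i(\theta)=1 .$$ Put $\Delta A_+=\sum_{i=1}^N\Delta A_i^+$ and $\Delta A_-=\sum_{i=1}^N\Delta A_i^-$, and consider the system $$\begin{aligned} \dot{\underline{x}}(t)&=A_0\underline{x}(t)-\Delta A_+\underline{x}^-(t)-\Delta A_-\overline{x}^+(t)+B^+\underline{d}(t)-B^-\overline{d}(t),\\ \dot{\overline{x}}(t)&=A_0\overline{x}(t)+\Delta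 A_+\overline{x}^+(t)+\Delta A_-\underline{x}^-(t)+B^+\overline{d}(t)-B^-\underline{d}(t). \end{aligned}\qquad (\mathrm{P})$$ Then: (i) The solution of (P) with initial conditions $\underline{x}(0)=\underline{x}_0$, $\overline{x}(0)=\overline{x}_0$ satisfies $\underline{x}(t)\le x(t)\le\overline{x}(t)$ for all $t\ge0$. (ii) If there exist diagonal matrices $P,Q,Q_+,Q_-,Z_+,Z_-,\Psi_+,\Psi_-,\Psi,\Gamma\in\mathbb{R}^{2n\times2n}$ such that $$P+\min\{Z_+,Z_-\}>0,\quad \Upsilon\preceq0,\quad \Gamma>0,\quad Q+\min\{Q_+,Q_-\}+2\min\{\Psi_+,\Psi_-\}>0,$$ where $$\Upsilon=\begin{bmatrix}\Upsilon_{11}&\Upsilon_{12}&\Upsilon_{13}&P\\ \Upsilon_{12}^\top&\Upsilon_{22}&\Upsilon_{23}&Z_+\\ \Upsilon_{13}^\top&\Upsilon_{23}^\top&\Upsilon_{33}&Z_-\\ P&Z_+&Z_-&-\Gamma\end{bmatrix},$$ $$\Upsilon_{11}=\mathcal{A}^\top P+P\mathcal{A}+Q,\quad \Upsilon_{12}=\mathcal{A}^\top Z_++PR_++\Psi_+,\quad \Upsilon_{13}=\mathcal{A}^\top Z_-+PR_-+\Psi_-,$$ $$\Upsilon_{22}=Z_+R_++R_+^\top Z_++Q_+,\quad \Upsilon_{23}=Z_+R_-+R_+^\top Z_-+\Psi,\quad \Upsilon_{33}=Z_-R_-+R_-^\top Z_-+Q_-,$$ $$\mathcal{A}=\begin{bmatrix}A_0&0\\0&A_0\end{bmatrix},\quad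 R_+=\begin{bmatrix}0&-\Delta A_-\\0&\Delta A_+\end{bmatrix},\quad R_-=\begin{bmatrix}\Delta A_+&0\\-\Delta A_-&0\end{bmatrix},$$ then the system (P), with state $(\underline{x},\overline{x})\in\mathbb{R}^{2n}$, is input-to-state stable with respect to the inputs $(\underline{d},\overline{d})$.
   Context: $\mathbb{R}_+=\{\tau\in\mathbb{R}:\tau\ge0\}$. $\mathcal{L}_\infty^k$ is the set of measurable, essentially bounded functions $\mathbb{R}_+\to\mathbb{R}^k$. Inequalities $\le$ between vectors or matrices are elementwise. For a matrix or vector $M$, $M^+=\max\{0,M\}$ (elementwise) and $M^-=M^+-M$, so both are elementwise nonnegative; e.g. $\underline{x}^-(t)=(\underline{x}(t))^-$ and $\Delta A_i^-=(\Delta A_i)^-$. A square matrix is Metzler if all its off-diagonal entries are nonnegative. For symmetric $M$, $M\preceq0$ means negative semidefinite. For diagonal matrices, $\min\{\cdot,\cdot\}$ is taken elementwise, and $D>0$ for a diagonal matrix $D$ means that all its diagonal entries are positive (equivalently, $D$ is positive definite). The diagonal matrices in (ii) are not individually required to be sign-definite beyond the listed inequalities. Solutions of differential equations are understood in the usual (absolutely continuous) sense. Input-to-state stability (standard notion): a system $\dot X=F(X,u)$ is input-to-state stable with respect to $u$ if there exist $\beta$ of class $\mathcal{KL}$ and $\gamma$ of class $\mathcal{K}$ such that, for every initial state $X(0)$ and every essentially bounded input $u$, the solution exists for all $t\ge0$ and satisfies $|X(t)|\le\beta(|X(0)|,t)+\gamma(\operatorname{ess\,sup}_{s\in[0,t)}|u(s)|)$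 for all $t\ge0$. In (ii), $X=(\underline{x},\overline{x})$ and $u=(\underline{d},\overline{d})$. *)

(* Defs.v *)
From HB Require Import structures.
From mathcomp Require Import all_boot all_order all_algebra.
From mathcomp Require Import all_classical all_reals all_analysis.
From mathcomp Require Import measurable_realfun ess_sup_inf.
Set Implicit Arguments.
Unset Strict Implicit.
Unset Printing Implicit Defensive.
Import Order.TTheory GRing.Theory Num.Theory.
Import numFieldNormedType.Exports.
Local Open Scope classical_set_scope.
Local Open Scope ring_scope.

Section Matrices.
Context {R : realType}.

Definition mxle {m n} (M M' : 'M[R]_(m, n)) : Prop :=
  forall i j, M i j <= M' i j.

Definition mxpos {m n} (M : 'M[R]_(m, n)) : 'M[R]_(m, n) :=
  map_mx (Num.max 0) M.

(* Elementwise nonnegative: M = mxpos M - mxneg M. *)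
Definition mxneg {m n} (M : 'M[R]_(m, n)) : 'M[R]_(m, n) := mxpos M - M.

Definition mxmin {m n} (M M' : 'M[R]_(m, n)) : 'M[R]_(m, n) :=
  map2_mx Num.min M M'.

Definition Metzler {n} (M : 'M[R]_n) : Prop :=
  forall i j, i != j -> 0 <= M i j.

(* Positivity of a diagonal matrix; only applied to diagonal matrices. *)
Definition diag_gt0 {n} (D : 'M[R]_n) : Prop := forall i, 0 < D i i.

(* Only applied to symmetric matrices. *)
Definition neg_semidef {n} (M : 'M[R]_n) : Prop :=
  forall v : 'cV[R]_n, (v^T *m M *m v) 0 0 <= 0.

(* Euclidean norm; the norm `|v| of the library is the maximum norm. *)
Definition enorm {n} (v : 'cV[R]_n) : R := Num.sqrt (\sum_i v i 0 ^+ 2).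

End Matrices.

(* A signal on R_+ is encoded as a function on R; its values at negative times
   are never used. *)
Section Signals.
Context {R : realType}.

(* Essential supremum over D of |u|.  The extension of |u| by 0 outside D does
   not change it, except that it is 0 (and not -oo) when D is negligible. *)
Definition ess_norm {k} (D : set R) (u : R -> 'cV[R]_k) : \bar R :=
  ess_sup (@lebesgue_measure R)
    (fun t => (if t \in D then enorm (u t) else 0)%:E).

(* Measurability is with respect to the Lebesgue sigma-algebra, i.e., the
   completion of the Borel sigma-algebra. *)
Definition lebesgue_measurable_fun (D : set R) (f : R -> R) : Prop :=
  @measurable_fun _ _
    (g_sigma_algebraType (completed_algebra_gen (@lebesgue_measure R))) R D f.

Definition Linfty {k} (u : R -> 'cV[R]_k) : Prop :=
  (forall i, lebesgue_measurable_fun `[0, +oo[ (fun t => u t i 0)) /\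
  (ess_norm `[0%R, +oo[ u < +oo)%E.

Definition abs_continuous (a b : R) (f : R -> R) : Prop :=
  forall e : R, 0 < e -> exists2 delta : R, 0 < delta &
    forall (k : nat) (l u : 'I_k -> R),
      (forall i, [/\ a <= l i, l i <= u i & u i <= b]) ->
      trivIset [set: 'I_k] (fun i => [set` `]l i, u i[]) ->
      \sum_i (u i - l i) < delta ->
      \sum_i `|f (u i) - f (l i)| < e.

(* X is locally absolutely continuous on R_+ and satisfies
   X'(t) = F t (X t) for almost every t > 0. *)
Definition is_solution {k} (F : R -> 'cV[R]_k -> 'cV[R]_k)
    (X : R -> 'cV[R]_k) : Prop :=
  (forall i (T : R), 0 < T -> abs_continuous 0 T (fun t => X t i 0)) /\
  {ae @lebesgue_measure R, forall t : R, 0 < t ->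
    forall i, is_derive t (1 : R) (fun s => X s i 0) (F t (X t) i 0)}.

End Signals.

Section InputToStateStability.
Context {R : realType}.

(* Functions on R_+ are encoded as functions on R. *)
Definition class_K (g : R -> R) : Prop :=
  [/\ {within `[0, +oo[, continuous g},
      (forall x y : R, 0 <= x -> x < y -> g x < g y) & g 0 = 0].

Definition class_KL (b : R -> R -> R) : Prop :=
  [/\ {within [set p : R * R | 0 <= p.1 /\ 0 <= p.2],
        continuous (fun p : R * R => b p.1 p.2)},
      (forall t : R, 0 <= t -> class_K (fun s => b s t)),
      (forall s t t' : R, 0 <= s -> 0 <= t -> t <= t' -> b s t' <= b s t) &
      (forall s : R, 0 <= s -> b s t @[t --> +oo] --> (0 : R))].

Definition input_to_state_stable {k l}
    (F : 'cV[R]_k -> 'cV[R]_l -> 'cV[R]_k) : Prop :=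
  exists b g, [/\ class_KL b, class_K g &
    forall (X0 : 'cV[R]_k) (u : R -> 'cV[R]_l), Linfty u ->
      (exists2 X, is_solution (fun t v => F v (u t)) X & X 0 = X0) /\
      (forall X, is_solution (fun t v => F v (u t)) X -> X 0 = X0 ->
        forall t : R, 0 <= t ->
          enorm (X t) <= b (enorm X0) t + g (fine (ess_norm `[0, t[ u)))].

End InputToStateStability.

Section IntervalPredictor.
Context {R : realType} {n m : nat}.

(* Right-hand side of the predictor, the state being (xl, xu) stacked as
   col_mx xl xu and the input (dl, du) as col_mx dl du; DAp and DAm are the
   sums of the positive and of the negative parts of the vertices. *)
Definition predictor (A0 DAp DAm : 'M[R]_n) (B : 'M[R]_(n, m))
    (X : 'cV[R]_(n + n)) (D : 'cV[R]_(m + m)) : 'cV[R]_(n + n) :=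
  let xl := usubmx X in let xu := dsubmx X in
  let dl := usubmx D in let du := dsubmx D in
  col_mx
    (A0 *m xl - DAp *m mxneg xl - DAm *m mxpos xu
       + mxpos B *m dl - mxneg B *m du)
    (A0 *m xu + DAp *m mxpos xu + DAm *m mxneg xl
       + mxpos B *m du - mxneg B *m dl).

End IntervalPredictor.

Definition Upsilon {R : realType} {k : nat}
    (A Rp Rm P Q Qp Qm Zp Zm Psip Psim Psi Gamma : 'M[R]_k) :
    'M[R]_((k + k) + (k + k)) :=
  let U11 := A^T *m P + P *m A + Q in
  let U12 := A^T *m Zp + P *m Rp + Psip in
  let U13 := A^T *m Zm + P *m Rm + Psim in
  let U22 := Zp *m Rp + Rp^T *m Zp + Qp in
  let U23 := Zp *m Rm + Rp^T *m Zm + Psi in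
  let U33 := Zm *m Rm + Rm^T *m Zm + Qm in
  block_mx
    (block_mx U11   U12
              U12^T U22)     (block_mx U13 P
                                       U23 Zp)
    (block_mx U13^T U23^T
              P     Zp)      (block_mx U33 Zm
                                       Zm  (- Gamma)).

(* Main.v *)
Require Import Defs.
From HB Require Import structures.
From mathcomp Require Import all_boot all_order all_algebra.
From mathcomp Require Import all_classical all_reals all_analysis.
From mathcomp Require Import measurable_realfun ess_sup_inf.
From mathcomp Require Import ring lra.
Set Implicit Arguments.
Unset Strict Implicit.
Unset Printing Implicit Defensive.
Import Order.TTheory GRing.Theory Num.Theory.
Import numFieldNormedType.Exports.
Local Open Scope classical_set_scope.
Local Open Scope ring_scope.

(* An absolutely continuous function whose derivative is a.e. nonpositive is
   nonincreasing, hence Gronwall's inequality holds for a.e. derivatives.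

   (i) Stack the errors e = (x - xl, xu - x).  As A0 is Metzler and the
   convex combination of the DA i lies between -DAm and DAp, whenever e_i < 0
   one has e_i' >= -K sum_j e_j^-, so that the sum of the squares of the e_i^-
   is at most exponential in time; it starts at 0, hence vanishes.

   (ii) V(X) = sum_i P_i X_i^2 + Zp_i (X_i^+)^2 + Zm_i (X_i^-)^2 is a C^1
   function and, for w = (X, X^+, -X^-, Bu), the inequality w^T Upsilon w <= 0
   is exactly V' <= -sum_i c_i(X_i) X_i^2 + sum_i Gamma_i (Bu)_i^2, where the
   c_i are positive because X_i^+ X_i^- = 0.  Since V is equivalent to |X|^2,
   Gronwall gives the estimate.

   Existence: the difference of X and a primitive of Bu solves an equation with
   a continuous globally Lipschitz right-hand side, to which Picard iteration
   in an exponentially weighted norm applies. *)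

(** * Absolutely continuous functions *)

(** Inputs are merely measurable, so trajectories are differentiable only almost everywhere and the
    mean value theorem does not apply to them; every estimate along a trajectory therefore rests on
    absolute continuity. Squares of parts are used because [Num.max 0 x ^+ 2], unlike [Num.max 0 x],
    is differentiable everywhere: the chain rule then holds wherever the trajectory is
    differentiable, also at sign changes. One function, [wsq], serves both claims: the coefficients
    0, 0, 1 give the squared negative part of (i), and the diagonal entries of [P], [Zp], [Zm] a
    summand of V in (ii). Only the lower bound of (i) needs computation, since swapping and negating
    the two bounds and the two inputs maps one equation of the predictor to the other. A further
    obstacle is that inputs are measurable for the completed sigma-algebra, whereas primitives are
    taken of Borel functions; hence the passage to Borel representatives. *)

Section RealInduction.
Context {R : realType}.

(** Take [c] to be the supremum of the points where [Q] holds. As the step goes from just left of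
    [c] to just right of it, a single hypothesis both reaches this supremum and passes beyond it,
    unless it equals [b]. *)
Lemma real_induction (a b : R) (Q : R -> Prop) : a <= b -> Q a ->
  (forall c, a <= c <= b -> exists2 e : R, 0 < e &
     forall s s', a <= s -> s <= c -> c <= s' -> s' <= b ->
       c - e < s -> s' < c + e -> Q s -> Q s') ->
  Q b.
Proof.
move=> ab Qa step.
pose S := [set t | a <= t <= b /\ Q t].
have Sa : S a by split => //; rewrite lexx.
have supS : has_sup S.
  by split; [exists a|exists b => t [/andP[]]].
have ac : a <= sup S by apply: ub_le_sup => //; case: supS.
have cb : sup S <= b by apply: ge_sup; [exists a|move=> t [/andP[]]].
have [e e0 He] := step (sup S) (introT andP (conj ac cb)).
have [s [/andP[as_ sb] Qs] cs] := sup_adherent e0 supS.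
have sc : s <= sup S by apply: ub_le_sup; [case: supS|split => //; apply/andP].
have Q' s' : sup S <= s' -> s' <= b -> s' < sup S + e -> Q s'.
  by move=> *; exact: (He s).
have [cltb|bc] := ltP (sup S) b; last first.
  by apply: Q' => //; rewrite (le_lt_trans bc) ?ltrDl.
pose s' := Num.min b (sup S + e / 2).
have s'b : s' <= b by rewrite /s' ge_min lexx.
have cs' : sup S < s' by rewrite /s' lt_min cltb ltrDl divr_gt0.
suff : s' <= sup S by rewrite leNgt cs'.
apply: ub_le_sup; first by case: supS.
split; first by rewrite s'b andbT (le_trans ac)// ltW.
apply: Q' => //; first exact: ltW.
rewrite /s' gt_min; apply/orP; right; lra.
Qed.

(* Nonoverlapping intervals inside U, listed from right to left in [a, t]. *)
Fixpoint chain (U : set R) (a : R) (s : seq (R * R)) (t : R) : Prop :=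
  if s is (l, u) :: s' then
    [/\ l <= u, u <= t, `]l, u[ `<=` U & chain U a s' l]
  else a <= t.

Lemma chain_ge U a s t : chain U a s t -> a <= t.
Proof.
elim: s t => [//|[l u] s ih] t /= [lu ut _ /ih al].
by rewrite (le_trans al)// (le_trans lu).
Qed.

Lemma chain_le U a s t t' : t <= t' -> chain U a s t -> chain U a s t'.
Proof.
case: s => [|[l u] s] /= tt'; first by move=> /le_trans; apply.
by move=> [lu ut lU cl]; split => //; exact: le_trans tt'.
Qed.

Lemma chain_nth U a s t (x0 : R * R) i : chain U a s t -> (i < size s)%N ->
  [/\ a <= (nth x0 s i).1, (nth x0 s i).1 <= (nth x0 s i).2
    & (nth x0 s i).2 <= t].
Proof.
elim: s t i => [//|[l u] s ih] t [|i] /= [lu ut _ ch].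
  by move=> _; split => //; exact: chain_ge ch.
rewrite ltnS => /(ih _ _ ch)[ai ii il]; split => //.
by rewrite (le_trans il)// (le_trans lu).
Qed.

Lemma chain_disjoint U a s t (x0 : R * R) i j : chain U a s t ->
  (i < j < size s)%N -> (nth x0 s j).2 <= (nth x0 s i).1.
Proof.
elim: s t i j => [|[l u] s ih] t i j /=; first by rewrite ltn0 andbF.
case: j => [//|j] /=.
move=> [lu ut _ ch]; rewrite ltnS; case: i => [|i] /=.
  by move=> js; have [] := chain_nth x0 ch js.
by rewrite ltnS => ij; exact: ih ch _.
Qed.

(** Induction on the list: the first interval is disjoint from the remaining ones, which are
    confined to the part of [U] left of [l], so the measures add. *)
Lemma chain_length U a s t : open U -> chain U a s t ->
  ((\sum_(p <- s) (p.2 - p.1))%:E <= @lebesgue_measure R (U `&` `]a, t[))%E.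
Proof.
move=> oU; elim: s t => [|[l u] s ih] t /=; first by rewrite big_nil.
move=> [lu ut lU ch]; rewrite big_cons /= EFinD.
have al := chain_ge ch.
apply: (@le_trans _ _ (@lebesgue_measure R `]l, u[%classic +
    @lebesgue_measure R (U `&` `]a, l[))%E).
  rewrite leeD ?ih// lebesgue_measure_itv/= lte_fin.
  by case: ltP => // ul; rewrite lee_fin subr_le0.
have mU : measurable U by exact: open_measurable.
rewrite -measureU//=; last 2 first.
- exact: measurableI.
- apply/seteqP; split=> // z /= [+ [_ +]]; rewrite !in_itv/= => /andP[lz _] /andP[_ zl].
  by move: (lt_trans lz zl); rewrite ltxx.
apply: le_measure; rewrite ?inE.
- by apply: measurableU => //; exact: measurableI.
- exact: measurableI.
move=> z [lzu|[Uz zal]].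
  split; first exact: lU.
  move: lzu; rewrite /= !in_itv/= => /andP[lz zu].
  by rewrite (le_lt_trans al)//= (lt_le_trans zu).
split => //; move: zal; rewrite /= !in_itv/= => /andP[-> zl]/=.
by rewrite (lt_le_trans zl)// (le_trans lu).
Qed.

End RealInduction.

(** * Monotonicity from an almost everywhere sign of the derivative *)

Section AbsoluteContinuity.
Context {R : realType}.
Implicit Types (a b : R) (f : R -> R).

(** The difference quotient tends to [D <= 0 < e]. Both sides of [t] are needed, as a step of the
    real induction starts before the point and ends after it. *)
Lemma is_derive_le0_near f (t D e : R) : 0 < e -> D <= 0 ->
  is_derive t (1 : R) f D ->
  exists2 r, 0 < r & forall y, `|y - t| < r ->
    (t <= y -> f y - f t <= e * (y - t)) /\ (y <= t -> f t - f y <= e * (t - y)).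
Proof.
move=> e0 D0 [df dfE].
have : (fun h => h^-1 *: ((f \o shift t) h%:A - f t)) @ 0^' --> D.
  by have := df; rewrite /derivable -dfE => /cvg_ex[l Hl]; rewrite /derive; rewrite (cvg_lim _ Hl).
move=> /cvgrPdist_lt /(_ e e0) [r /= r0 Hr].
exists r => // y yr.
have key : y != t -> `|D - (y - t)^-1 * (f y - f t)| < e.
  move=> yt; have := Hr (y - t).
  rewrite /= sub0r normrN => /(_ yr).
  rewrite /shift /= [(y - t)%:A](_ : _ = y - t) ?subrK; last by rewrite /GRing.scale/= mulr1.
  by apply; rewrite subr_eq0.
split => yt.
- have [->|ynt] := eqVneq y t; first by rewrite !subrr mulr0.
  have := key ynt; rewrite ltr_norml => /andP[h _].
  have ty : 0 < y - t by rewrite subr_gt0 lt_neqAle eq_sym ynt.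
  rewrite -ler_pdivrMr// mulrC; lra.
- have [->|ynt] := eqVneq y t; first by rewrite !subrr mulr0.
  have := key ynt; rewrite ltr_norml => /andP[h _].
  have ty : 0 < t - y by rewrite subr_gt0 lt_neqAle ynt.
  rewrite -ler_pdivrMr// mulrC -(opprB y t) -(opprB (f y)) invrN mulrNN; lra.
Qed.

(** The form in which absolute continuity enters the monotonicity argument: a chain inside an open
    set of small measure carries little variation, whatever its number of intervals. *)
Lemma abs_continuous_chain a b f e : abs_continuous a b f -> 0 < e ->
  exists2 delta, 0 < delta & forall U s, open U ->
    (@lebesgue_measure R U < delta%:E)%E -> chain U a s b ->
    \sum_(p <- s) `|f p.2 - f p.1| < e.
Proof.
move=> acf e0; have [delta d0 H] := acf e e0.
exists delta => // U s oU mU ch.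
rewrite (big_nth (0, 0)) big_mkord; apply: H.
- by move=> i; exact: chain_nth ch _.
- apply/trivIsetP => i j _ _ ij; apply/seteqP; split=> // z /= [].
  rewrite !in_itv/= => /andP[lz zu] /andP[lz' zu'].
  wlog ltij : i j ij lz zu lz' zu' / (i < j)%N.
    move: (ij); rewrite neq_ltn => /orP[ltij w|ltij w]; first exact: (w i j).
    by apply: (w j i) => //; rewrite eq_sym.
  have := @chain_disjoint _ _ _ _ _ (0, 0) i j ch.
  by rewrite ltij ltn_ord => /(_ isT); lra.
- rewrite -(big_mkord xpredT (fun i => (nth (0, 0) s i).2 - (nth (0, 0) s i).1)).
  rewrite -(big_nth (0, 0) xpredT (fun p => p.2 - p.1)) -lte_fin.
  rewrite (le_lt_trans (chain_length oU ch))// (le_lt_trans _ mU)//.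
  have mU' : measurable U by exact: open_measurable.
  by apply: le_measure; rewrite ?inE//; exact: measurableI.
Qed.

(* Cover the null set of bad times by a small open set U: real induction
   reaches b from a by steps on which f increases by at most e times the
   length, and steps inside U, over which f varies by less than e in total. *)
Lemma abs_continuous_nonincreasing a b f : a <= b -> abs_continuous a b f ->
  {ae @lebesgue_measure R, forall t, a < t < b ->
     exists2 D, D <= 0 & is_derive t (1 : R) f D} ->
  f b <= f a.
Proof.
move=> ab acf [M [mM M0 badM]].
suff main e : 0 < e -> f b - f a <= e * (b - a) + e.
  rewrite -subr_le0; apply/ler_addgt0Pl => e e0; rewrite addr0.
  have c0 : 0 < b - a + 1 by lra.
  have := main (e / (b - a + 1)); rewrite divr_gt0// => /(_ isT)/le_trans; apply.
  by rewrite -{2}(mulr1 (_ / _)) -mulrDr divfK// gt_eqF.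
move=> e0; have [delta d0 Hdelta] := abs_continuous_chain acf e0.
(* The endpoints are added because the derivative is controlled only on the open interval; a point
   of the segment outside [U] is then interior, with a nonpositive derivative. *)
pose M' := M `|` [set a; b].
have mM' : measurable M' by apply: measurableU => //; apply: measurableU.
have M'0 : @lebesgue_measure R M' = 0.
  apply/eqP; rewrite -measure_le0 (le_trans (measureU2 _ _ _))//; first exact: measurableU.
  rewrite [X in (X + _)%E]M0 add0e (le_trans (measureU2 _ _ _))//.
  by rewrite [X in (X + _)%E]lebesgue_measure_set1
    [X in (_ + X)%E]lebesgue_measure_set1 adde0.
have [|U [oU M'U UM']] := @lebesgue_regularity_outer R M' delta mM' _ d0.
  by rewrite [X in (X < _)%E]M'0.
have mU : (@lebesgue_measure R U < delta%:E)%E.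
  have mU : measurable U by exact: open_measurable.
  rewrite -(setDUK M'U) (le_lt_trans (measureU2 _ _ _))//; first exact: measurableD.
  by rewrite [X in (X + _)%E]M'0 add0e.
pose Q t := exists2 s, chain U a s t &
  f t - f a <= e * (t - a) + \sum_(p <- s) `|f p.2 - f p.1|.
suff [s chs fs] : Q b.
  by rewrite (le_trans fs)// lerD2l ltW// (Hdelta U).
apply: (real_induction ab).
  by exists nil => /=; rewrite ?big_nil ?subrr ?mulr0 ?addr0.
move=> c /andP[ac cb].
have [Uc|nUc] := pselect (U c).
- have [r /= r0 rU] : nbhs c U by exact: open_nbhs_nbhs.
  exists r => // s s' as_ sc cs' s'b rs rs' [l chl fl].
  exists ((s, s') :: l) => /=.
    split => //; first exact: le_trans cs'.
    move=> z /=; rewrite in_itv/= => /andP[sz zs']; apply: rU => /=.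
    by rewrite ltr_norml; apply/andP; split; lra.
  rewrite big_cons /=.
  have := ler_norm (f s' - f s).
  have : e * (s - a) <= e * (s' - a) by rewrite ler_pM2l//; lra.
  by move: fl; lra.
- have acb : a < c < b.
    rewrite !lt_neqAle ac cb !andbT; apply/andP; split; apply/eqP => E; apply: nUc.
      by apply: M'U; right; left.
    by apply: M'U; right; right.
  have [D D0 cD] : exists2 D, D <= 0 & is_derive c (1 : R) f D.
    apply: contrapT => nD; apply: nUc; apply: M'U; left; apply: badM => /=.
    by move=> /(_ acb).
  have [r r0 Hr] := is_derive_le0_near e0 D0 cD.
  exists r => // s s' as_ sc cs' s'b rs rs' [l chl fl].
  exists l; first by apply: chain_le chl; exact: le_trans cs'.
  have := (Hr s _).2 sc; have := (Hr s' _).1 cs'.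
  rewrite !ltr_norml => /(_ _)h1 /(_ _)h2.
  have {}h1 : f s' - f c <= e * (s' - c) by apply: h1; apply/andP; split; lra.
  have {}h2 : f c - f s <= e * (c - s) by apply: h2; apply/andP; split; lra.
  nra.
Qed.

End AbsoluteContinuity.

(** * Closure properties and Gronwall's inequality *)

Section AbsoluteContinuityTheory.
Context {R : realType}.
Implicit Types (a b : R) (f : R -> R).

Lemma abs_continuous_id a b : abs_continuous a b (@id R).
Proof.
move=> e e0; exists e => // k l u lu _ H.
rewrite (eq_bigr (fun i => u i - l i))// => i _.
by rewrite ger0_norm// subr_ge0; have [] := lu i.
Qed.

(** Common source of the closure properties: differences, products and squares of bounded functions,
    Lipschitz functions. *)
Lemma abs_continuous_dominated (I : finType) (f : I -> R -> R) (K : R) a b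
    (g : R -> R) :
  (forall i, abs_continuous a b (f i)) -> 0 <= K ->
  (forall x y, a <= x <= b -> a <= y <= b ->
    `|g y - g x| <= K * \sum_i `|f i y - f i x|) ->
  abs_continuous a b g.
Proof.
move=> acf K0 gf e e0.
(* The two [+ 1] keep [c] positive when [K = 0] or [I] is empty, and make the final inequality
   strict. *)
pose c := (K + 1) * (#|I|%:R + 1).
have c0 : 0 < c by rewrite mulr_gt0// ltr_wpDl// ler0n.
have ec0 : 0 < e / c by rewrite divr_gt0.
have /choice[d Hd] : forall i, exists d, 0 < d /\ forall (k : nat) (l u : 'I_k -> R),
      (forall i, [/\ a <= l i, l i <= u i & u i <= b]) ->
      trivIset [set: 'I_k] (fun i => [set` `]l i, u i[]) ->
      \sum_i (u i - l i) < d ->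
      \sum_j `|f i (u j) - f i (l j)| < e / c.
  by move=> i; have [d d0 H] := acf i _ ec0; exists d.
exists (\big[Num.min/1]_i d i).
  by apply: lt_bigmin => //i _; have [] := Hd i.
move=> k l u lu tI lud.
apply: (@le_lt_trans _ _ (K * \sum_i \sum_j `|f i (u j) - f i (l j)|)).
  rewrite exchange_big /= mulr_sumr; apply: ler_sum => j _.
  have [al lu' ub] := lu j.
  by apply: gf; apply/andP; split=> //; [exact: le_trans ub|exact: le_trans lu'].
apply: (@le_lt_trans _ _ (K * (#|I|%:R * (e / c)))).
  rewrite ler_wpM2l// mulr_natl -sumr_const; apply: ler_sum => i _.
  apply: ltW; have [_] := Hd i; apply => //.
  by rewrite (lt_le_trans lud)//; exact: bigmin_le_cond.
rewrite !mulrA ltr_pdivrMr// mulrC ltr_pM2l// /c.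
have : 0 <= #|I|%:R :> R by rewrite ler0n.
by move: K0; clear; nra.
Qed.

Lemma abs_continuous_uniform a b f : abs_continuous a b f ->
  forall e, 0 < e -> exists2 d, 0 < d & forall x y,
    a <= x <= b -> a <= y <= b -> `|y - x| < d -> `|f y - f x| < e.
Proof.
move=> acf e e0; have [d d0 H] := acf e e0; exists d => // x y.
wlog xy : x y / x <= y.
  have [xy w|/ltW yx w] := leP x y; first exact: w.
  by move=> hx hy; rewrite distrC [X in _ -> X < _]distrC; exact: w.
move=> /andP[ax xb] /andP[ay yb]; rewrite ger0_norm ?subr_ge0// => yxd.
have := H 1%N (fun=> x) (fun=> y); rewrite !big_ord1; apply=> //.
by apply/trivIsetP => i j _ _; rewrite !ord1 eqxx.
Qed.

(** Real induction with uniform continuity at scale 1: near [c] the values stay within 1 of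
    [f c]. *)
Lemma abs_continuous_bounded a b f : a <= b -> abs_continuous a b f ->
  exists M, forall x, a <= x <= b -> `|f x| <= M.
Proof.
move=> ab acf.
have [d d0 H] := abs_continuous_uniform acf ltr01.
apply: (@real_induction R a b
  (fun t => exists M, forall x, a <= x <= t -> `|f x| <= M)) => //.
  by exists `|f a| => x /andP[ax xa]; rewrite (@le_anti _ _ x a)// ax xa.
move=> c acb; exists d => // s s' as_ sc cs' s'b ds ds' [M HM].
exists (Num.max M (`|f c| + 1)) => x /andP[ax xs'].
rewrite le_max; have [xs|sx] := leP x s; first by rewrite HM// ax xs.
apply/orP; right.
have := H c x acb; rewrite ax (le_trans xs')// => /(_ isT) h.
have {}h : `|f x - f c| < 1 by apply: h; rewrite ltr_norml; apply/andP; split; lra.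
by have := ler_normB (f x - f c) (- f c); rewrite opprK subrK normrN; move: h; lra.
Qed.

Lemma abs_continuousB a b f g :
  abs_continuous a b f -> abs_continuous a b g -> abs_continuous a b (f \- g).
Proof.
move=> acf acg; apply: (@abs_continuous_dominated bool
  (fun i => if i then f else g) 1) => //; first by case.
move=> x y _ _; rewrite big_bool/= mul1r.
have -> : f y - g y - (f x - g x) = (f y - f x) - (g y - g x) by ring.
exact: ler_normB.
Qed.

Lemma abs_continuous_lipschitz (K : R) a b f : 0 <= K ->
  (forall x y, a <= x <= b -> a <= y <= b -> `|f y - f x| <= K * `|y - x|) ->
  abs_continuous a b f.
Proof.
move=> K0 H; apply: (@abs_continuous_dominated 'I_1 (fun=> id) K) => //.
  by move=> _; exact: abs_continuous_id.
by move=> x y hx hy; rewrite big_ord1; exact: H.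
Qed.

Lemma expR_lipschitz (c M : R) : 0 <= M -> exists2 K, 0 <= K &
  forall x y, `|x| <= M -> `|y| <= M ->
    `|expR (c * y) - expR (c * x)| <= K * `|y - x|.
Proof.
move=> M0; exists (`|c| * expR (`|c| * M)); first by rewrite mulr_ge0// expR_ge0.
move=> x y; wlog xy : x y / x <= y.
  have [xy w|/ltW yx w] := leP x y; first exact: w.
  by move=> hx hy; rewrite distrC [X in _ <= _ * X]distrC; exact: w.
move=> hx hy.
have dE (z : R) : is_derive z (1 : R) (fun z : R => expR (c * z)) (expR (c * z) * c).
  apply: (@is_derive1_comp _ expR (fun z => c * z)).
  by apply: is_derive_eq; rewrite /GRing.scale/= mulr1.
have [|z + ->] := @MVT_segment R (fun z => expR (c * z)) _ x y xy (fun z _ => dE z).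
  apply: continuous_subspaceT => z.
  by apply: differentiable_continuous; apply/derivable1_diffP; case: (dE z).
rewrite in_itv/= => /andP[xz zy].
rewrite normrM ler_wpM2r// normrM mulrC ler_wpM2l//.
rewrite ger0_norm ?expR_ge0// ler_expR (le_trans (ler_norm _))// normrM.
rewrite ler_wpM2l//; move: hx hy; rewrite !ler_norml => /andP[? ?] /andP[? ?].
by apply/andP; split; lra.
Qed.

(** Both signs of [a] occur: positive for the invariance in (i), negative for the decay in (ii). *)
Lemma abs_continuous_gronwall (a b T : R) f : 0 <= T -> a != 0 ->
  abs_continuous 0 T f ->
  {ae @lebesgue_measure R, forall t, 0 < t < T ->
     exists2 D, is_derive t (1 : R) f D & D <= a * f t + b} ->
  f T <= expR (a * T) * (f 0 + b / a) - b / a.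
Proof.
move=> T0 a0 acf aef.
(* The shift by [b / a] absorbs the constant term, so that the integrating factor yields a
   nonpositive derivative. *)
pose g t := expR (- a * t) * (f t + b / a).
have acg : abs_continuous 0 T g.
  have [M HM] := abs_continuous_bounded T0 acf.
  have M0 : 0 <= M by rewrite (le_trans _ (HM 0 _))// lexx.
  have [K K0 HK] := expR_lipschitz (- a) T0.
  pose E := expR (`|a| * T).
  have E0 : 0 <= E by exact: expR_ge0.
  apply: (@abs_continuous_dominated bool (fun i => if i then f else id)
    (E + K * (M + `|b / a|))).
  - by case=> //; exact: abs_continuous_id.
  - by rewrite addr_ge0// mulr_ge0// addr_ge0.
  move=> x y hx hy; rewrite big_bool /=.
  have -> : g y - g x = expR (- a * y) * (f y - f x) +
      (expR (- a * y) - expR (- a * x)) * (f x + b / a) by rewrite /g; ring.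
  rewrite (le_trans (ler_normD _ _))// !normrM mulrDr.
  have fx : `|f x + b / a| <= M + `|b / a|.
    by rewrite (le_trans (ler_normD _ _))// lerD2r HM.
  have Ey : `|expR (- a * y)| <= E.
    rewrite ger0_norm ?expR_ge0// ler_expR (le_trans (ler_norm _))// normrM normrN.
    by rewrite ler_wpM2l//; move: hy => /andP[y0 yT]; rewrite ger0_norm.
  have eyx : `|expR (- a * y) - expR (- a * x)| <= K * `|y - x|.
    by apply: HK; rewrite ger0_norm; case/andP: hx; case/andP: hy.
  apply: lerD.
    apply: ler_pM => //; rewrite (le_trans Ey)// lerDl mulr_ge0// addr_ge0//.
  rewrite (le_trans (ler_pM _ _ eyx fx))// mulrAC ler_wpM2r//.
  by rewrite -normrM lerDr.
have : g T <= g 0.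
  apply: (abs_continuous_nonincreasing T0 acg).
  apply: (@filterS _ _ (ae_filter_ringOfSetsType _)) aef => t H /H[D dfD DE].
  exists (expR (- a * t) * (D - a * f t - b)); first by rewrite pmulr_rle0 ?expR_gt0//; lra.
  have d1 : is_derive t (1 : R) (fun z : R => expR (- a * z)) (expR (- a * t) * - a).
    apply: (@is_derive1_comp _ expR (fun z => - a * z)).
    by apply: is_derive_eq; rewrite /GRing.scale/= mulr1.
  have d2 : is_derive t (1 : R) (fun z => f z + b / a) D.
    have := is_deriveD dfD (is_derive_cst (b / a) t 1).
    by rewrite addr0.
  have d3 : is_derive t (1 : R) g _ := is_deriveM d1 d2.
  apply: (is_derive_eq d3).
  rewrite /GRing.scale/=; field => //.
rewrite /g mulr0 expR0 mul1r => h.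
rewrite lerBrDr -(ler_pM2l (expR_gt0 (- a * T))) mulrA -expRD mulNr addNr expR0 mul1r.
by rewrite -mulNr.
Qed.

End AbsoluteContinuityTheory.

(** * Piecewise quadratic functions *)

Section PiecewiseQuadratic.
Context {R : realType}.

(** With this criterion the point 0, where the parts have a kink, is treated like any other. *)
Lemma is_derive_quadratic_remainder (f : R -> R) (x d K : R) : 0 <= K ->
  (forall y, `|f y - f x - d * (y - x)| <= K * (y - x) ^+ 2) ->
  is_derive x (1 : R) f d.
Proof.
move=> K0 H.
have cvd : (fun h => h^-1 *: ((f \o shift x) h%:A - f x)) @ 0^' --> d.
  apply/cvgrPdist_lt => e e0.
  have K1 : 0 < K + 1 by lra.
  exists (e / (K + 1)) => /=; first by rewrite divr_gt0.
  move=> h /=; rewrite sub0r normrN ltr_pdivlMr// => he h0.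
  rewrite [h%:A](_ : _ = h); last by rewrite /GRing.scale/= mulr1.
  rewrite /GRing.scale /=.
  have {}H : `|f (h + x) - f x - d * h| <= K * (`|h| * `|h|).
    by have := H (h + x); rewrite addrK -normrM -expr2 ger0_norm ?sqr_ge0.
  have h0' : 0 < `|h| by rewrite normr_gt0.
  rewrite -(ltr_pM2l h0') -normrM mulrBr mulVKf// distrC (mulrC h d).
  by rewrite (le_lt_trans H)// mulrCA ltr_pM2l//; move: h0' he K0; clear; nra.
have df : derivable f x 1 by apply/cvg_ex; exists d.
by split=> //; exact: (cvg_lim _ cvd).
Qed.

Definition wsq (p q r x : R) : R :=
  p * x ^+ 2 + q * Num.max 0 x ^+ 2 + r * Num.max 0 (- x) ^+ 2.

Definition dwsq (p q r x : R) : R :=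
  2 * (p * x + q * Num.max 0 x - r * Num.max 0 (- x)).

(** Lower bound: convexity of the squared positive part. Upper bound: its derivative
    [2 * Num.max 0 x] is 2-Lipschitz. *)
Lemma sq_pos_remainder (x y : R) :
  0 <= Num.max 0 y ^+ 2 - Num.max 0 x ^+ 2 - 2 * Num.max 0 x * (y - x)
    <= (y - x) ^+ 2.
Proof.
have := sqr_ge0 (y - x); have := sqr_ge0 x; have := sqr_ge0 y; rewrite !expr2.
by case: (leP 0 x) => x0; case: (leP 0 y) => y0 *; apply/andP; split; nra.
Qed.

Lemma is_derive_wsq (p q r x : R) :
  is_derive x (1 : R) (wsq p q r) (dwsq p q r x).
Proof.
apply: (@is_derive_quadratic_remainder _ _ _ (`|p| + `|q| + `|r|)) => [|y].
  by rewrite !addr_ge0.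
have /andP[Y0 Y1] := sq_pos_remainder x y.
have /andP[Z0 Z1] := sq_pos_remainder (- x) (- y).
set Y := (X in 0 <= X) in Y0 Y1; set Z := (X in 0 <= X) in Z0 Z1.
have -> : wsq p q r y - wsq p q r x - dwsq p q r x * (y - x) =
    p * (y - x) ^+ 2 + q * Y + r * Z by rewrite /wsq /dwsq /Y /Z; ring.
have Z1' : Z <= (y - x) ^+ 2 by rewrite (le_trans Z1)// -opprD sqrrN.
rewrite (le_trans (ler_normD _ _))// 2!mulrDl lerD ?(le_trans (ler_normD _ _))//.
  by rewrite lerD// normrM ler_wpM2l// ger0_norm// sqr_ge0.
by rewrite normrM ler_wpM2l// ger0_norm.
Qed.

Lemma max0_lipschitz (x y : R) : `|Num.max 0 y - Num.max 0 x| <= `|y - x|.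
Proof.
rewrite ler_norml.
have := ler_norm (y - x); have := ler_norm (- (y - x)); rewrite normrN.
by case: (leP 0 x) => x0; case: (leP 0 y) => y0 h1 h2; apply/andP; split; lra.
Qed.

Lemma norm_max0 (x : R) : `|Num.max 0 x| <= `|x|.
Proof. by have := max0_lipschitz 0 x; rewrite maxxx !subr0. Qed.

Lemma sqr_lipschitz (M x y : R) : `|x| <= M -> `|y| <= M ->
  `|y ^+ 2 - x ^+ 2| <= 2 * M * `|y - x|.
Proof.
move=> xM yM; rewrite subr_sqr normrM mulrC ler_wpM2r//.
by rewrite (le_trans (ler_normD _ _))//; lra.
Qed.

Lemma wsq_lipschitz (p q r M x y : R) : `|x| <= M -> `|y| <= M ->
  `|wsq p q r y - wsq p q r x| <= 2 * M * (`|p| + `|q| + `|r|) * `|y - x|.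
Proof.
move=> xM yM; have M0 : 0 <= 2 * M by have := normr_ge0 x; lra.
have H1 := sqr_lipschitz xM yM.
have H2 : `|Num.max 0 y ^+ 2 - Num.max 0 x ^+ 2| <= 2 * M * `|y - x|.
  rewrite (le_trans (sqr_lipschitz (M := M) _ _)) ?(le_trans (norm_max0 _))//.
  by rewrite ler_wpM2l// max0_lipschitz.
have H3 : `|Num.max 0 (- y) ^+ 2 - Num.max 0 (- x) ^+ 2| <= 2 * M * `|y - x|.
  rewrite (le_trans (sqr_lipschitz (M := M) _ _)) ?(le_trans (norm_max0 _)) ?normrN//.
  by rewrite ler_wpM2l// (le_trans (max0_lipschitz _ _))// -opprD normrN.
have -> : wsq p q r y - wsq p q r x = p * (y ^+ 2 - x ^+ 2) +
   q * (Num.max 0 y ^+ 2 - Num.max 0 x ^+ 2) +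
   r * (Num.max 0 (- y) ^+ 2 - Num.max 0 (- x) ^+ 2) by rewrite /wsq; ring.
rewrite [leRHS]mulrAC [leRHS]mulrC mulrDl [X in _ <= X + _]mulrDl.
rewrite (le_trans (ler_normD _ _))// lerD//.
  by rewrite (le_trans (ler_normD _ _))// lerD// normrM ler_wpM2l.
by rewrite normrM ler_wpM2l.
Qed.

Definition wsqn k (p q r : 'I_k -> R) (v : 'cV[R]_k) : R :=
  \sum_i wsq (p i) (q i) (r i) (v i 0).

Lemma abs_continuous_wsqn k (p q r : 'I_k -> R) (E : R -> 'cV[R]_k) (T : R) :
  0 <= T -> (forall i, abs_continuous 0 T (fun t => E t i 0)) ->
  abs_continuous 0 T (fun t => wsqn p q r (E t)).
Proof.
move=> T0 acE.
have /choice[M HM] : forall i, exists M, forall x, 0 <= x <= T -> `|E x i 0| <= M.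
  by move=> i; exact: abs_continuous_bounded.
have M0 i : 0 <= M i by rewrite (le_trans _ (HM i 0 _))// lexx.
pose c i := 2 * M i * (`|p i| + `|q i| + `|r i|).
have c0 i : 0 <= c i by rewrite !mulr_ge0// !addr_ge0.
apply: (@abs_continuous_dominated _ _ _ (\sum_i c i) _ _ _ acE).
  by apply: sumr_ge0.
move=> x y hx hy; rewrite /wsqn -sumrB (le_trans (ler_norm_sum _ _ _))//.
rewrite mulr_sumr; apply: ler_sum => i _.
rewrite (le_trans (wsq_lipschitz _ _ _ (HM i x hx) (HM i y hy)))//.
by rewrite ler_wpM2r// (bigD1 i)//= lerDl sumr_ge0.
Qed.

Lemma is_derive_wsqn k (p q r : 'I_k -> R) (E : R -> 'cV[R]_k) (t : R)
    (D : 'I_k -> R) :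
  (forall i, is_derive t (1 : R) (fun s => E s i 0) (D i)) ->
  is_derive t (1 : R) (fun s => wsqn p q r (E s))
    (\sum_i dwsq (p i) (q i) (r i) (E t i 0) * D i).
Proof.
move=> dE.
have -> : (fun s => wsqn p q r (E s)) =
    \sum_i (fun s => wsq (p i) (q i) (r i) (E s i 0)).
  by apply/funext => s; rewrite fct_sumE.
apply: is_derive_sum => i.
exact: (@is_derive1_comp _ (wsq (p i) (q i) (r i)) (fun s => E s i 0) _ _ _
  (is_derive_wsq _ _ _ _) (dE i)).
Qed.

(** Cauchy-Schwarz against the all-ones vector, from [f i * f j <= (f i ^+ 2 + f j ^+ 2) / 2]. *)
Lemma sqr_sum_le k (f : 'I_k -> R) :
  (\sum_i f i) ^+ 2 <= k%:R * \sum_i f i ^+ 2.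
Proof.
have : \sum_i \sum_j f i * f j <= \sum_i \sum_j (f i ^+ 2 + f j ^+ 2) / 2.
  apply: ler_sum => i _; apply: ler_sum => j _.
  by rewrite ler_pdivlMr//; have := sqr_ge0 (f i - f j); nra.
rewrite -big_distrlr /= -expr2 => /le_trans; apply.
under eq_bigr do rewrite -mulr_suml big_split/= sumr_const card_ord.
rewrite -mulr_suml big_split/= sumr_const card_ord sumrMnl -mulr_natl; lra.
Qed.

(* Gronwall applied to the sum of the squared negative parts. *)
Lemma nonneg_invariance k (E : R -> 'cV[R]_k) (K T : R) : 0 <= K -> 0 <= T ->
  (forall i, abs_continuous 0 T (fun t => E t i 0)) ->
  (forall i, 0 <= E 0 i 0) ->
  {ae @lebesgue_measure R, forall t, 0 < t < T -> exists D : 'I_k -> R,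
    forall i, is_derive t (1 : R) (fun s => E s i 0) (D i) /\
      (E t i 0 < 0 -> - K * (\sum_j Num.max 0 (- E t j 0)) <= D i)} ->
  forall i, 0 <= E T i 0.
Proof.
move=> K0 T0 acE E0 aeE.
pose V := wsqn (fun=> 0) (fun=> 0) (fun _ : 'I_k => 1).
have VE v : V v = \sum_i Num.max 0 (- v i 0) ^+ 2 :> R.
  by apply: eq_bigr => i _; rewrite /wsq !mul0r !add0r mul1r.
(* Where [E t i 0] is negative, its square grows at most at the rate [2 * K * S] times the negative
   part; summing gives [2 * K * S ^+ 2 <= 2 * K * k%:R * V]. The [+ 1] makes the rate nonzero, as
   Gronwall's inequality divides by it. *)
pose a := 2 * K * k%:R + 1.
have a0 : 0 < a by rewrite ltr_wpDl// !mulr_ge0// ler0n.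
have : V (E T) <= expR (a * T) * (V (E 0) + 0 / a) - 0 / a.
  apply: (@abs_continuous_gronwall _ a 0 T (fun t => V (E t))) => //.
  - by rewrite gt_eqF.
  - exact: abs_continuous_wsqn.
  apply: (@filterS _ _ (ae_filter_ringOfSetsType _) _ _ _ aeE) => t H /H[D HD].
  exists (\sum_i dwsq 0 0 1 (E t i 0) * D i).
    by apply: is_derive_wsqn => i; have [] := HD i.
  rewrite /= addr0 VE; set S := \sum_j _ in HD.
  have S0 : 0 <= S by apply: sumr_ge0 => i _; rewrite le_max lexx.
  apply: (@le_trans _ _ (\sum_i 2 * K * S * Num.max 0 (- E t i 0))).
    apply: ler_sum => i _; have [_] := HD i.
    rewrite /dwsq !mul0r !add0r mul1r.
    have [Ei _|Ei /(_ isT) DE] := leP 0 (E t i 0).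
      have -> : Num.max 0 (- E t i 0) = 0 by apply/max_idPl; rewrite oppr_le0.
      by rewrite oppr0 !mulr0 mul0r.
    have -> : Num.max 0 (- E t i 0) = - E t i 0 by apply/max_idPr; lra.
    by move: Ei DE S0 K0; clear; nra.
  rewrite -mulr_sumr -/S -mulrA -expr2.
  have := sqr_sum_le (fun i => Num.max 0 (- E t i 0)).
  rewrite -/S; set W := \sum_i _ => SW.
  have W0 : 0 <= W by apply: sumr_ge0 => i _; exact: sqr_ge0.
  by rewrite /a; move: SW W0 K0; clear; nra.
have -> : V (E 0) = 0.
  rewrite VE big1// => i _; have -> : Num.max 0 (- E 0 i 0) = 0.
    by apply/max_idPl; rewrite oppr_le0.
  by rewrite expr0n.
rewrite mul0r addr0 mulr0 subr0 VE => VT i.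
rewrite leNgt; apply/negP => Ei.
have : 0 < Num.max 0 (- E T i 0) ^+ 2 by rewrite exprn_gt0// lt_max oppr_gt0 Ei orbT.
rewrite ltNge; apply/negP; rewrite negbK (le_trans _ VT)//.
by rewrite (bigD1 i)//= lerDl sumr_ge0// => j _; exact: sqr_ge0.
Qed.

End PiecewiseQuadratic.

(** * Existence of solutions *)

Section BorelModification.
Context {R : realType}.
Notation mu := (@lebesgue_measure R).

Lemma ae_null (P : R -> Prop) : {ae mu, forall t, P t} ->
  exists2 N : set R, measurable N /\ mu N = 0%E & forall t, ~ N t -> P t.
Proof.
move=> [N [mN N0 PN]]; exists N => // t nNt; apply: contrapT => nP.
exact: nNt (PN t nP).
Qed.

Lemma null_ae (N : set R) (P : R -> Prop) : measurable N -> mu N = 0%E ->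
  (forall t, ~ N t -> P t) -> {ae mu, forall t, P t}.
Proof.
move=> mN N0 NP; exists N; split => // t /= nPt; apply: contrapT => nNt.
exact: nPt (NP t nNt).
Qed.

(* The preimages of the countably many rational half-lines are Borel up to a
   common null set, outside of which f is left unchanged. *)
Lemma borel_modification (f : R -> R) (M : R) :
  lebesgue_measurable_fun `[0, +oo[ f -> 0 <= M ->
  {ae mu, forall t, 0 <= t -> `|f t| <= M} ->
  exists g : R -> R, [/\ measurable_fun [set: R] g, (forall t, `|g t| <= M)
    & {ae mu, forall t, 0 <= t -> g t = f t}].
Proof.
move=> mf M0 /ae_null[N [mN N0] fN].
pose D : set R := `[0, +oo[%classic.
have [enum enumP] : exists enum : nat -> option rat, forall q, exists n, enum n = Some q.
  by exists unpickle => q; exists (pickle q); exact: pickleK.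
(* A set of the completed sigma-algebra is Borel up to a negligible set; enlarging the latter to a
   Borel null set [B] gives equality off [B]. *)
have HD (q : rat) : exists A B : set R, [/\ measurable A, measurable B, mu B = 0%E
    & (D `&` f @^-1` `]ratr q, +oo[) `\` B = A `\` B].
  have : (completed_algebra_gen mu).-sigma.-measurable
      (D `&` f @^-1` `]ratr q, +oo[%classic).
    apply: mf => //.
    rewrite g_sigma_completed_algebra_genE; exists D; first exact: measurable_itv.
    by exists set0; [exact: negligible_set0|rewrite setU0].
  rewrite g_sigma_completed_algebra_genE => -[A mA [N' negN <-]].
  case: negN => /= B [mB B0 NB].
  exists A, B; split => //; rewrite setDUl [X in _ `|` X](_ : _ = set0) ?setU0//.
  by apply/seteqP; split=> // z [/NB].
have /choice[A HA] := HD.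
have /choice[B HB] := HA.
pose BB : set R := \bigcup_n (if enum n is Some q then B q else set0).
have mBB : measurable BB.
  apply: bigcupT_measurable => n; case: (enum n) => // q.
  by have [] := HB q.
have BB0 : mu BB = 0%E.
  apply: measure_negligible => //; apply: negligible_bigcup => n.
  case: (enum n) => [q|]; last exact: negligible_set0.
  by have [_ mB B0 _] := HB q; apply/negligibleP.
pose E := D `\` (N `|` BB).
have mE : measurable E by apply: measurableD; [exact: measurable_itv|exact: measurableU].
have mfE : measurable_fun E f.
  apply: (measurability _ (RGenOInfty.measurableE R)) => //.
  move=> _ [_ [x ->] <-].
  (* On [E], membership in [A q] means [f z > q], and [f z > x] holds iff [f z > q] for some
     rational [q > x]. *)
  have -> : E `&` f @^-1` `]x, +oo[%classic = \bigcup_n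
      (if enum n is Some q then
         if x < ratr q then E `&` A q else set0 else set0).
    apply/seteqP; split => z.
      move=> [Ez]; rewrite /= in_itv/= andbT => /rat_in_itvoo[q].
      rewrite in_itv/= => /andP[xq qf].
      have [n nq] := enumP q; exists n => //; rewrite nq xq; split => //.
      have [_ _ _ H] := HB q.
      have : (A q `\` B q) z.
        rewrite -H; case: Ez => Dz nz; split.
          by split=> //=; rewrite in_itv/= andbT.
        by move=> Bz; apply: nz; right; exists n => //; rewrite nq.
      by case.
    move=> [n _]; case nq: (enum n) => [q|//]; case: ifP => // xq [Ez Az].
    split=> //=; rewrite in_itv/= andbT.
    have [_ _ _ H] := HB q.
    have : (A q `\` B q) z.
      split=> // Bz; case: Ez => _; apply; right.
      by exists n => //; rewrite nq.
    by rewrite -H => -[[_]]; rewrite /= in_itv/= andbT => /(lt_trans xq).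
  apply: bigcupT_measurable => n; case: (enum n) => // q; case: ifP => // _.
  by apply: measurableI => //; have [] := HB q.
(* Extension by 0 off [E], which also makes the bound [M] valid everywhere. *)
exists (f \_ E); split.
- exact/(measurable_restrictT _ _).1.
- move=> t; rewrite patchE; case: ifPn => [|_]; last by rewrite normr0.
  rewrite inE => -[Dt nt]; apply: fN; first by move=> Nt; apply: nt; left.
  by move: Dt; rewrite /D/= in_itv/= andbT.
- apply: (@null_ae (N `|` BB)); first exact: measurableU.
    apply/eqP; rewrite -measure_le0 (le_trans (measureU2 _ _ _))//.
    by rewrite [X in (X + _)%E]N0 [X in (_ + X)%E]BB0 adde0.
  move=> t nt t0; rewrite patchE ifT// inE; split=> //.
  by rewrite /D/= in_itv/= andbT.
Qed.

End BorelModification.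

(** * Indefinite integrals of bounded Borel functions *)

Section Primitives.
Context {R : realType}.
Notation mu := (@lebesgue_measure R).

(* Based at -1 rather than 0 so as to be differentiable on all of [0, +oo[. *)
Definition primitive (g : R -> R) (t : R) : R :=
  \int[mu]_(s in `[(-1), t]) g s - \int[mu]_(s in `[(-1), 0]) g s.

Lemma primitive0 g : primitive g 0 = 0.
Proof. by rewrite /primitive subrr. Qed.

Lemma bounded_integrable (g : R -> R) (M : R) (A : set R) :
  measurable A -> (mu A < +oo)%E -> measurable_fun A g ->
  (forall t, A t -> `|g t| <= M) -> mu.-integrable A (EFin \o g).
Proof.
move=> mA Aoo mg gM; apply: measurable_bounded_integrable => //.
exists M; split; first by rewrite num_real.
by move=> x Mx y Ay; rewrite /= (le_trans (gM y Ay))// ltW.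
Qed.

Lemma primitive_lipschitz (g : R -> R) (M s t : R) :
  measurable_fun [set: R] g -> (forall t, `|g t| <= M) ->
  0 <= s -> s <= t -> `|primitive g t - primitive g s| <= M * (t - s).
Proof.
move=> mg gM s0 st.
have int_itv (i : interval R) : (mu [set` i] < +oo)%E -> mu.-integrable [set` i] (EFin \o g).
  by move=> ioo; apply: (bounded_integrable (M := M)) => //; exact: measurable_funS mg.
have itvoo (x y : R) b b' : (mu [set` Interval (BSide b x) (BSide b' y)] < +oo)%E.
  rewrite lebesgue_measure_itv; case: ifP => _; rewrite ?ltry//.
have -> : primitive g t - primitive g s = \int[mu]_(x in `]s, t]) g x.
  rewrite /primitive -[RHS](@Rintegral_itvB _ g (BLeft (-1)) (BRight t) s).
  - by rewrite opprB addrA subrK.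
  - exact: int_itv.
  - by rewrite bnd_simp; lra.
  - by rewrite bnd_simp.
rewrite (le_trans (le_normr_Rintegral _ _))//; first exact: int_itv.
apply: (@le_trans _ _ (\int[mu]_(x in `]s, t]) M)).
  apply: le_Rintegral => //.
  - apply: (bounded_integrable (M := M)) => //.
      by apply: measurableT_comp => //; exact: measurable_funS mg.
    by move=> x _; rewrite normr_id.
  - by apply: (bounded_integrable (M := `|M|)) => // x _.
rewrite Rintegral_cst// [X in fine X]lebesgue_measure_itv/= lte_fin.
by case: ltP => //= ts; rewrite mulr0 mulr_ge0 ?subr_ge0// (le_trans _ (gM 0)).
Qed.

Lemma is_derive_primitive_ae (g : R -> R) (M : R) :
  measurable_fun [set: R] g -> (forall t, `|g t| <= M) ->
  {ae mu, forall t : R, 0 < t -> is_derive t (1 : R) (primitive g) (g t)}.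
Proof.
move=> mg gM.
have intg y : mu.-integrable [set` Interval (BLeft (-1)) (BRight y)] (EFin \o g).
  apply: (bounded_integrable (M := M)) => //; last exact: measurable_funS mg.
  by rewrite lebesgue_measure_itv; case: ifP => _; rewrite ?ltry.
have locg : locally_integrable [set: R] g.
  split => //; first exact: openT.
  move=> K _ cK.
  have := @bounded_integrable g M K (compact_measurable cK) (compact_finite_measure cK).
  move=> /(_ (measurable_funS measurableT _ mg) (fun t _ => gM t)) /integrableP[] //.
apply: (@filterS _ _ (ae_filter_ringOfSetsType _) _ _ _ (FTC1 intg locg)) => t H t0.
have [|d1 d2] := H.
  by apply: lt_trans t0; lra.
have d3 : is_derive t (1 : R) (fun x : R => \int[mu]_(t in `[(-1), x]) g t : R) (g t).
  by split; [exact: d1|rewrite -derive1E; exact: d2].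
have := is_deriveB d3 (is_derive_cst (\int[mu]_(s in `[(-1), 0]) g s) t 1).
by rewrite subr0.
Qed.

Lemma is_derive_primitive (g : R -> R) (t : R) : continuous g -> -1 < t ->
  is_derive t (1 : R) (primitive g) (g t).
Proof.
move=> cg t0.
have [||d1 d2] := @continuous_FTC1_closed R g (-1) t (t + 1) _ _ t0 (cg t).
- by rewrite ltrDl.
- apply: continuous_compact_integrable; first exact: segment_compact.
  exact: continuous_subspaceT.
have d3 : is_derive t (1 : R) (fun x : R => \int[mu]_(t in `[(-1), x]) g t : R) (g t).
  by split; [exact: d1|rewrite -derive1E; exact: d2].
have := is_deriveB d3 (is_derive_cst (\int[mu]_(s in `[(-1), 0]) g s) t 1).
by rewrite subr0.
Qed.

End Primitives.

(** * Picard iteration *)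

Section Picard.
Context {R : realType}.

(** Counterpart of [abs_continuous_dominated], used to pass from the entries of a vector to a
    Lipschitz function of it. *)
Lemma dominated_continuous (I : finType) (f : I -> R -> R) (K : R) (g : R -> R) :
  (forall i, continuous (f i)) -> 0 <= K ->
  (forall x y, `|g y - g x| <= K * \sum_i `|f i y - f i x|) ->
  continuous g.
Proof.
move=> cf K0 gf x; apply/cvgrPdist_lt => e e0.
pose c := (K + 1) * (#|I|%:R + 1).
have c0 : 0 < c by rewrite mulr_gt0// ltr_wpDl// ler0n.
have ec0 : 0 < e / c by rewrite divr_gt0.
have H : \forall y \near x, forall i, `|f i x - f i y| < e / c.
  apply: (@filter_forall _ _ (fun i y => `|f i x - f i y| < e / c) _ (nbhs_filter x)) => i.
  by have /cvgrPdist_lt := cf i x; apply.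
near=> y; have fxy : forall i, `|f i x - f i y| < e / c by near: y.
apply: (le_lt_trans (gf y x)).
apply: (@le_lt_trans _ _ (K * (#|I|%:R * (e / c)))).
  by rewrite ler_wpM2l// mulr_natl -sumr_const; apply: ler_sum => i _;
    exact/ltW/fxy.
rewrite !mulrA ltr_pdivrMr// mulrC ltr_pM2l// /c.
have : 0 <= #|I|%:R :> R by rewrite ler0n.
by move: K0; clear; nra.
Unshelve. all: by end_near. Qed.

Lemma continuous_max0 : continuous (fun t : R => Num.max 0 t).
Proof.
apply: (@dominated_continuous 'I_1 (fun=> id) 1) => //.
  by move=> _ x; exact: cvg_id.
by move=> x y; rewrite big_ord1 mul1r; exact: max0_lipschitz.
Qed.

Lemma is_derive_continuous (f : R -> R) (x d : R) :
  is_derive x (1 : R) f d -> {for x, continuous f}.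
Proof. by move=> [df _]; apply: differentiable_continuous; exact/derivable1_diffP. Qed.

(** Integration gains the factor [1 / k], which is what makes a Picard step contract in a weighted
    norm. The proof compares derivatives, for [h] and for [- h], instead of estimating an
    integral. *)
Lemma is_derive_growth (h g : R -> R) (c k t : R) : 0 < k ->
  (forall s : R, 0 <= s -> is_derive s (1 : R) h (g s)) -> h 0 = 0 ->
  (forall s, 0 <= s -> `|g s| <= c * expR (k * s)) -> 0 <= t ->
  `|h t| <= c / k * expR (k * t).
Proof.
move=> k0 dh h0 gc t0.
have c0 : 0 <= c.
  by have := gc 0 (lexx _); rewrite mulr0 expR0 mulr1; apply: le_trans.
suff H (s : R) : `|s| = 1 -> s * h t <= c / k * expR (k * t).
  rewrite ler_norml -lerN2 opprK; apply/andP; split.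
    by rewrite -mulN1r; apply: H; rewrite normrN1.
  by rewrite -[h t]mul1r; apply: H; rewrite normr1.
move=> s1.
pose phi x := s * h x - c / k * expR (k * x).
have dphi (x : R) : 0 <= x -> is_derive x (1 : R) phi (s * g x - c * expR (k * x)).
  move=> x0.
  have d1 : is_derive x (1 : R) (fun z : R => expR (k * z)) (expR (k * x) * k).
    apply: (@is_derive1_comp _ expR (fun z => k * z)).
    by apply: is_derive_eq; rewrite /GRing.scale/= mulr1.
  have d2 := is_deriveB (is_deriveZ s (dh x x0)) (is_deriveZ (c / k) d1).
  apply: (is_derive_eq d2); rewrite /GRing.scale/=; field.
  by rewrite gt_eqF.
have [||z + E] := @MVT_segment R phi (fun x => s * g x - c * expR (k * x)) 0 t t0.
- by move=> x; rewrite in_itv/= => /andP[/ltW x0 _]; exact: dphi.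
- apply: derivable_within_continuous => x; rewrite in_itv/= => /andP[x0 _].
  by case: (dphi x x0).
rewrite in_itv/= => /andP[z0 _].
have : phi t <= phi 0.
  rewrite -subr_le0 E subr0 mulr_le0_ge0// subr_le0.
  by rewrite (le_trans (ler_norm _))// normrM s1 mul1r gc.
rewrite /phi h0 mulr0 sub0r mulr0 expR0 mulr1.
have : 0 <= c / k by rewrite divr_ge0// ltW.
lra.
Qed.

(** The intervals of radius [2 * C * 2^-1 ^+ m] around [y m] are nested, and the limit is the
    supremum of their left ends. The explicit rate later gives convergence locally uniform in
    time. *)
Lemma geometric_limit (y : nat -> R) (C : R) : 0 <= C ->
  (forall m, `|y m.+1 - y m| <= C * 2^-1 ^+ m) ->
  exists l, forall m, `|l - y m| <= 2 * C * 2^-1 ^+ m.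
Proof.
move=> C0 Hy.
have h0 m : 0 <= C * 2^-1 ^+ m by rewrite mulr_ge0// exprn_ge0.
pose a m := y m - 2 * C * 2^-1 ^+ m; pose b m := y m + 2 * C * 2^-1 ^+ m.
have aS m : a m <= a m.+1.
  rewrite /a exprS; have := Hy m; rewrite ler_norml => /andP[]; have := h0 m; lra.
have bS m : b m.+1 <= b m.
  rewrite /b exprS; have := Hy m; rewrite ler_norml => /andP[]; have := h0 m; lra.
have amono : {homo a : i j / (i <= j)%N >-> i <= j}.
  by apply: homo_leq => // ? ? ?; exact: le_trans.
have bmono : {homo b : i j / (i <= j)%N >-> j <= i}.
  by apply: (homo_leq (r := fun x y => y <= x)) => // u v w h1 h2; exact: le_trans h2 h1.
have ab i j : a i <= b j.
  apply: (le_trans (amono i (maxn i j) (leq_maxl _ _))).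
  apply: le_trans (bmono j (maxn i j) (leq_maxr _ _)).
  by rewrite /a /b; have := h0 (maxn i j); lra.
exists (sup (range a)) => m; rewrite ler_norml; apply/andP; split.
  have : a m <= sup (range a).
    by apply: ub_le_sup; [exists (b 0%N) => _ [i _ <-]|exists m].
  by rewrite /a; lra.
have : sup (range a) <= b m.
  by apply: ge_sup; [exists (a 0%N), 0%N|move=> _ [i _ <-]].
by rewrite /b; lra.
Qed.

Lemma geometric_small (c e : R) : 0 < e -> exists m, c * 2^-1 ^+ m < e.
Proof.
move=> e0; have [c0|c0] := leP c 0.
  by exists 0%N; rewrite expr0 mulr1 (le_lt_trans c0).
exists (Num.Def.archi_bound (c / e)).
rewrite exprVn ltr_pdivrMr ?exprn_gt0// mulrC -ltr_pdivrMr//.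
rewrite (lt_trans (archi_boundP _)) ?divr_ge0 ?ltW//.
by rewrite -natrX ltr_nat ltn_expl.
Qed.

Context (k : nat) (Phi : 'cV[R]_k -> 'cV[R]_k) (L M : R).
Context (U : R -> 'cV[R]_k) (x0 : 'cV[R]_k).
Context (L0 : 0 <= L) (PhiL : forall v w i,
  `|Phi v i 0 - Phi w i 0| <= L * \sum_j `|v j 0 - w j 0|).
Context (cU : forall j, continuous (fun t => U t j 0)).
Context (M0 : 0 <= M) (UM : forall j t, 0 <= t -> `|U t j 0| <= M * t).

Let cont (Y : R -> 'cV[R]_k) := forall j, continuous (fun t => Y t j 0).
Let field (Y : R -> 'cV[R]_k) j s := Phi (Y s + U s) j 0.
(* Frozen at negative times, so that the iterates are continuous on R. *)
Let step (Y : R -> 'cV[R]_k) t :=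
  \col_j (x0 j 0 + primitive (field Y j) (Num.max 0 t)).
(* With this exponent, step is a 1/2-contraction for the norm
   sup_t |Y t| / E t. *)
Let kappa := 2 * L * k%:R + 1.
Let E t := expR (kappa * Num.max 0 t).

(** This is the purpose of the [+ 1] in [kappa]: [expR (kappa * s)] then dominates [1 + s], hence
    the linear growth of [U] in the first iterate. *)
Let kappa_ge1 : 1 <= kappa.
Proof. by rewrite /kappa lerDr !mulr_ge0. Qed.

Let kappa_gt0 : 0 < kappa. Proof. exact: lt_le_trans kappa_ge1. Qed.

Let cont_field Y j : cont Y -> continuous (field Y j).
Proof.
move=> cY; apply: (@dominated_continuous ('I_k + 'I_k)%type
  (fun i t => match i with inl i => Y t i 0 | inr i => U t i 0 end) L) => //.
  by case.
move=> s t; rewrite /field (le_trans (PhiL _ _ _))// ler_wpM2l//.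
rewrite big_sumType/= -big_split/=; apply: ler_sum => i _.
by rewrite !mxE (le_trans _ (ler_normD _ _))// addrACA opprD.
Qed.

Let cont_step Y : cont Y -> cont (step Y).
Proof.
move=> cY j t.
rewrite (_ : (fun t => _) = (fun t => x0 j 0 + primitive (field Y j) (Num.max 0 t))).
  apply: cvgD; first exact: cvg_cst.
  apply: (@continuous_comp _ _ _ (fun t : R => Num.max 0 t : R)
    (primitive (field Y j))); first exact: continuous_max0.
  apply: is_derive_continuous; apply: is_derive_primitive; first exact: cont_field.
  by rewrite (@lt_le_trans _ _ 0)// ?ltrN10// le_max lexx.
by apply/funext => s; rewrite mxE.
Qed.

Let max0_ge0 (t : R) : 0 <= Num.max 0 t. Proof. by rewrite le_max lexx. Qed.

(** The Lipschitz bound costs [L * k%:R], [is_derive_growth] divides by [kappa], and the quotient is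
    at most 1/2. *)
Let step_contract Y Z c : cont Y -> cont Z ->
  (forall t j, `|Y t j 0 - Z t j 0| <= c * E t) ->
  forall t j, `|step Y t j 0 - step Z t j 0| <= c * 2^-1 * E t.
Proof.
move=> cY cZ H t j; rewrite !mxE opprD addrACA subrr add0r.
have c0 : 0 <= c.
  by have := H 0 j; rewrite /E maxxx mulr0 expR0 mulr1; apply: le_trans.
apply: (@le_trans _ _ (L * k%:R * c / kappa * E t)).
  apply: (@is_derive_growth (primitive (field Y j) \- primitive (field Z j))
    (fun s => field Y j s - field Z j s)) => //.
  - move=> s s0.
    by apply: is_deriveB; apply: is_derive_primitive;
      rewrite ?(lt_le_trans _ s0)//; exact: cont_field.
  - by rewrite /= !primitive0 subrr.
  - move=> s s0; rewrite /field (le_trans (PhiL _ _ _))// -!mulrA ler_wpM2l//.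
    rewrite -[X in X%:R](card_ord k) mulr_natl -sumr_const; apply: ler_sum => i _.
    rewrite !mxE opprD addrACA subrr addr0 (le_trans (H _ _))// /E.
    by rewrite (max_idPr s0).
rewrite ler_wpM2r ?expR_ge0// ler_pdivrMr// /kappa.
by move: c0; lra.
Qed.

Let Yn m := iter m step (fun=> x0).

Let cont_Yn m : cont (Yn m).
Proof.
elim: m => [|m ih]; last exact: cont_step.
by move=> j; exact: cst_continuous.
Qed.

(** Chosen so that the field along the constant iterate [x0] is at most [C0 * (1 + s)]; the second
    term accounts for [U]. *)
Let C0 := \sum_j `|Phi x0 j 0| + L * k%:R * M.

Let C0_ge0 : 0 <= C0.
Proof. by rewrite addr_ge0 ?sumr_ge0// !mulr_ge0. Qed.

Let Yn_diff m t j : `|Yn m.+1 t j 0 - Yn m t j 0| <= C0 * 2^-1 ^+ m * E t.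
Proof.
elim: m t j => [|m ih] t j; last first.
  rewrite exprSr mulrA.
  exact: (step_contract (@cont_Yn m.+1) (@cont_Yn m) ih).
rewrite expr0 mulr1 /Yn/= !mxE addrAC subrr add0r.
apply: (@le_trans _ _ (C0 / kappa * E t)); last first.
  by rewrite ler_wpM2r ?expR_ge0// ler_pdivrMr// ler_peMr.
apply: (@is_derive_growth _ (field (fun=> x0) j)) => //.
- move=> s s0; apply: is_derive_primitive; rewrite ?(lt_le_trans _ s0)//.
  by apply: cont_field => i; exact: cst_continuous.
- exact: primitive0.
move=> s s0; apply: (@le_trans _ _ (C0 * (1 + s))); last first.
  rewrite ler_wpM2l// (le_trans (expR_ge1Dx s))// ler_expR.
  by rewrite ler_peMl.
have : `|field (fun=> x0) j s - Phi x0 j 0| <= L * k%:R * M * s.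
  rewrite /field (le_trans (PhiL _ _ _))// -!mulrA ler_wpM2l//.
  rewrite -[X in X%:R](card_ord k) mulr_natl -sumr_const; apply: ler_sum => i _.
  by rewrite mxE addrAC subrr add0r UM.
have : `|Phi x0 j 0| <= \sum_j `|Phi x0 j 0|.
  by rewrite (bigD1 j)//= lerDl sumr_ge0.
have : 0 <= L * k%:R * M * 1 by rewrite !mulr_ge0.
have := ler_normD (field (fun=> x0) j s - Phi x0 j 0) (Phi x0 j 0).
rewrite subrK /C0; set S := \sum_j _; set A := `|_|; set B := `|_|; set F := `|_|.
have : 0 <= S * s by rewrite mulr_ge0// sumr_ge0.
lra.
Qed.

Lemma picard_existence : exists Y : R -> 'cV[R]_k, [/\ Y 0 = x0,
  (forall j, continuous (fun t => Y t j 0)) &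
  forall j (t : R), 0 < t -> is_derive t (1 : R) (fun s => Y s j 0) (Phi (Y t + U t) j 0)].
Proof.
have E0 t : 0 <= E t by exact: expR_ge0.
have : forall t, exists v : 'cV[R]_k,
    forall j m, `|v j 0 - Yn m t j 0| <= 2 * C0 * 2^-1 ^+ m * E t.
  move=> t.
  have /choice[l Hl] : forall j, exists l,
      forall m, `|l - Yn m t j 0| <= 2 * (C0 * E t) * 2^-1 ^+ m.
    move=> j; apply: geometric_limit; first by rewrite mulr_ge0.
    by move=> m; rewrite mulrAC.
  by exists (\col_j l j) => j m; rewrite mxE (le_trans (Hl j m))// !mulrA mulrAC.
move=> /choice[Y HY].
have cE : continuous E.
  move=> t; apply: continuous_comp; last exact: continuous_expR.
  by apply: cvgM; [exact: cvg_cst|exact: continuous_max0].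
have cY : cont Y.
  move=> j t; apply/cvgrPdist_lt => e e0.
  (* The weight [E] stays below [E t + 1] near [t], so one [m] serves all nearby times and a
     three-term estimate applies. *)
  have [m Hm] := geometric_small (2 * C0 * (E t + 1)) (divr_gt0 e0 (ltr0n R 3)).
  near=> s.
  have Es : E s < E t + 1.
    have : `|E t - E s| < 1 by near: s; have /cvgrPdist_lt := cE t; apply.
    by rewrite ltr_norml; lra.
  have Ys : `|Yn m t j 0 - Yn m s j 0| < e / 3%:R.
    near: s; have /cvgrPdist_lt := @cont_Yn m j t; apply; exact: divr_gt0.
  have bound r : E r <= E t + 1 -> `|Y r j 0 - Yn m r j 0| < e / 3%:R.
    move=> Er; rewrite (le_lt_trans (HY r j m))// (le_lt_trans _ Hm)//.
    by rewrite [leRHS]mulrAC ler_wpM2l// !mulr_ge0// exprn_ge0.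
  have := bound t; have := bound s (ltW Es).
  rewrite lerDl ler01 => h1 /(_ isT) h2.
  have -> : Y t j 0 - Y s j 0 = (Y t j 0 - Yn m t j 0) +
    (Yn m t j 0 - Yn m s j 0) - (Y s j 0 - Yn m s j 0) by ring.
  rewrite (le_lt_trans (ler_normB _ _))// (le_lt_trans (lerD (ler_normD _ _) (lexx _)))//.
  by move: h1 h2 Ys; lra.
(* Both sides are within [C0 * 2^-1 ^+ m * E t] of the iterate [m.+1], for every [m]. *)
have stepY t j : step Y t j 0 = Y t j 0.
  apply/eqP; rewrite -subr_eq0 -normr_eq0 eq_le normr_ge0 andbT.
  rewrite leNgt; apply/negP => d0.
  have [m Hm] := geometric_small (2 * C0 * E t) d0.
  have h1 : `|step Y t j 0 - Yn m.+1 t j 0| <= 2 * C0 * 2^-1 ^+ m * 2^-1 * E t.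
    exact: (step_contract cY (@cont_Yn m) (fun t j => HY t j m)).
  have := HY t j m.+1; rewrite exprSr mulrA => h2.
  have := ler_normB (step Y t j 0 - Yn m.+1 t j 0) (Y t j 0 - Yn m.+1 t j 0).
  rewrite opprB addrA subrK; move: h1 h2 Hm d0.
  set a := `|_|; set b := `|_|; set c := `|_|.
  lra.
exists Y; split => //.
  by apply/colP => j; rewrite -stepY mxE maxxx primitive0 addr0.
move=> j t t0.
have : is_derive t (1 : R) (fun s => x0 j 0 + primitive (field Y j) s) (field Y j t).
  rewrite -[field Y j t]add0r; apply: is_deriveD.
  by apply: is_derive_primitive; [exact: cont_field|exact: lt_trans t0].
apply: near_eq_is_derive; near=> s.
have s0 : 0 < s by near: s; exact: lt_nbhsr.
by rewrite -stepY mxE (max_idPr (ltW s0)).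
Unshelve. all: by end_near. Qed.

End Picard.

(** * Solutions for essentially bounded measurable inputs *)

Section Existence.
Context {R : realType}.
Notation mu := (@lebesgue_measure R).

Lemma enorm_ge0 k (v : 'cV[R]_k) : 0 <= enorm v.
Proof. exact: sqrtr_ge0. Qed.

Lemma sqr_enorm k (v : 'cV[R]_k) : enorm v ^+ 2 = \sum_i v i 0 ^+ 2.
Proof. by rewrite sqr_sqrtr// sumr_ge0// => i _; exact: sqr_ge0. Qed.

Lemma entry_le_enorm k (v : 'cV[R]_k) i : `|v i 0| <= enorm v.
Proof.
rewrite -sqrtr_sqr ler_wsqrtr// (bigD1 i)//= lerDl sumr_ge0// => j _.
exact: sqr_ge0.
Qed.

Lemma lebesgue_measureT_gt0 : (0 < mu [set: R])%E.
Proof.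
apply: (@lt_le_trans _ _ (mu `[0%R, 1%R]%classic)).
  by rewrite lebesgue_measure_itv/= lte_fin ltr01 lte_fin subr0.
by apply: le_measure; rewrite ?inE.
Qed.

Lemma ess_norm_ge0 k (D : set R) (u : R -> 'cV[R]_k) : (0 <= ess_norm D u)%E.
Proof.
apply: ess_sup_gee; first exact: lebesgue_measureT_gt0.
by apply: nearW => t; rewrite lee_fin; case: ifP => // _; exact: enorm_ge0.
Qed.

Lemma le_ess_norm k (D D' : set R) (u : R -> 'cV[R]_k) : D `<=` D' ->
  (ess_norm D u <= ess_norm D' u)%E.
Proof.
move=> DD'; apply: le_ess_sup; apply: nearW => t; rewrite lee_fin.
case: ifPn => [|_]; last by case: ifP => // _; exact: enorm_ge0.
by rewrite inE => /DD'; rewrite -inE => ->.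
Qed.

Lemma enorm_le_ess_norm k (D : set R) (u : R -> 'cV[R]_k) :
  (ess_norm D u < +oo)%E ->
  {ae mu, forall t, D t -> enorm (u t) <= fine (ess_norm D u)}.
Proof.
move=> uoo; have fin : ess_norm D u \is a fin_num.
  by rewrite ge0_fin_numE// ess_norm_ge0.
apply: (@filterS _ _ (ae_filter_ringOfSetsType _) _ _ _ (ess_sup_ge mu (fun t =>
  (if t \in D then enorm (u t) else 0)%:E))) => t + Dt.
by rewrite mem_set// -lee_fin fineK.
Qed.

Lemma ae_forall (I : finType) (P : I -> R -> Prop) :
  (forall i, {ae mu, forall t, P i t}) -> {ae mu, forall t, forall i, P i t}.
Proof. by move=> H; exact: (@filter_forall _ _ _ _ (ae_filter_ringOfSetsType _)). Qed.

(** Each entry is replaced by a bounded Borel representative before integrating. Freezing the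
    primitive at negative times by [Num.max 0 t] makes the Lipschitz bound hold on all of [R]. *)
Lemma Linfty_primitive k (u : R -> 'cV[R]_k) : Linfty u ->
  exists (U : R -> 'cV[R]_k) (M : R), [/\ 0 <= M, U 0 = 0,
    forall j s t, `|U t j 0 - U s j 0| <= M * `|t - s| &
    {ae mu, forall t : R, 0 < t -> forall j,
      is_derive t (1 : R) (fun s => U s j 0) (u t j 0)}].
Proof.
move=> [mf /enorm_le_ess_norm]; set M := fine _ => uM.
have M0 : 0 <= M by rewrite fine_ge0// ess_norm_ge0.
have /choice[g Hg] : forall j, exists g : R -> R,
    [/\ measurable_fun [set: R] g, (forall t, `|g t| <= M)
      & {ae mu, forall t, 0 <= t -> g t = u t j 0}].
  move=> j; apply: borel_modification => //.
  apply: (@filterS _ _ (ae_filter_ringOfSetsType _) _ _ _ uM) => t H t0.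
  by rewrite (le_trans (entry_le_enorm _ _))// H//= in_itv/= t0.
exists (fun t => \col_j primitive (g j) (Num.max 0 t)), M; split => //.
- by apply/colP => j; rewrite !mxE maxxx primitive0.
- move=> j s t; rewrite !mxE; have [mg gM _] := Hg j.
  apply: (@le_trans _ _ (M * `|Num.max 0 t - Num.max 0 s|)); last first.
    by rewrite ler_wpM2l// max0_lipschitz.
  have pos x : 0 <= Num.max 0 x :> R by rewrite le_max lexx.
  wlog st : s t / Num.max 0 s <= Num.max 0 t.
    have [st w|/ltW ts w] := leP (Num.max 0 s) (Num.max 0 t); first exact: w.
    by rewrite distrC (distrC (Num.max 0 t)); exact: w.
  have -> : `|Num.max 0 t - Num.max 0 s| = Num.max 0 t - Num.max 0 s.
    by rewrite ger0_norm ?subr_ge0.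
  exact: primitive_lipschitz.
have H1 : {ae mu, forall t : R, forall j,
    0 < t -> is_derive t (1 : R) (primitive (g j)) (g j t)}.
  apply: (ae_forall (P := fun j (t : R) =>
    0 < t -> is_derive t (1 : R) (primitive (g j)) (g j t))) => j.
  by have [mg gM _] := Hg j; exact: is_derive_primitive_ae gM.
have H2 : {ae mu, forall t : R, forall j, 0 <= t -> g j t = u t j 0}.
  apply: (ae_forall (P := fun j (t : R) => 0 <= t -> g j t = u t j 0)) => j.
  by have [] := Hg j.
apply: (@filterS2 _ _ (ae_filter_ringOfSetsType _) _ _ _ _ H1 H2) => t {}H1 {}H2 t0 j.
rewrite -(H2 j (ltW t0)); apply: near_eq_is_derive (H1 j t0); near=> s.
have s0 : 0 < s by near: s; exact: lt_nbhsr.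
by rewrite mxE (max_idPr (ltW s0)).
Unshelve. all: by end_near. Qed.

(** Mean value theorem with the maximum of the absolute value of [f] on [[0, T]]; it supplies the
    absolute continuity that [is_solution] demands of the Picard part. *)
Lemma derivable_lipschitz (h f : R -> R) (T : R) : continuous h -> continuous f ->
  (forall t : R, 0 < t -> is_derive t (1 : R) h (f t)) ->
  exists2 K, 0 <= K & forall x y, 0 <= x <= T -> 0 <= y <= T ->
    `|h y - h x| <= K * `|y - x|.
Proof.
move=> ch cf dh; have [T0|T0] := leP 0 T; last first.
  by exists 0 => // x y /andP[x0 xT]; have := le_trans x0 xT; rewrite leNgt T0.
have cnf : continuous (fun t => `|f t|) by move=> t; apply: cvg_norm; exact: cf.
have [c _ Hc] := @EVT_max _ (fun t => `|f t|) 0 T T0 (continuous_subspaceT cnf).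
exists `|f c| => // x y; wlog xy : x y / x <= y.
  have [xy w|/ltW yx w] := leP x y; first exact: w.
  by move=> hx hy; rewrite distrC [X in _ <= _ * X]distrC; exact: w.
move=> /andP[x0 xT] /andP[y0 yT].
have [||z + ->] := @MVT_segment R h f x y xy.
- by move=> z; rewrite in_itv/= => /andP[xz _]; apply: dh; exact: le_lt_trans xz.
- exact: continuous_subspaceT.
rewrite in_itv/= => /andP[xz zy]; rewrite normrM ler_wpM2r//.
by apply: Hc; rewrite in_itv/= (le_trans x0)// (le_trans zy).
Qed.

(* Subtracting a primitive of G u turns the right-hand side into a continuous
   function of time. *)
Lemma solution_exists k l (Phi : 'cV[R]_k -> 'cV[R]_k) (L : R) (G : 'M[R]_(k, l))
    (u : R -> 'cV[R]_l) (x0 : 'cV[R]_k) : 0 <= L ->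
  (forall v w i, `|Phi v i 0 - Phi w i 0| <= L * \sum_j `|v j 0 - w j 0|) ->
  Linfty u ->
  exists2 X, is_solution (fun t v => Phi v + G *m u t) X & X 0 = x0.
Proof.
move=> L0 PhiL /Linfty_primitive[U [M [M0 U0 UM dU]]].
pose W t := G *m U t.
pose c := (\sum_i \sum_j `|G i j|) * M.
have c0 : 0 <= c by rewrite mulr_ge0// sumr_ge0// => i _; rewrite sumr_ge0.
have Wlip j s t : `|W t j 0 - W s j 0| <= c * `|t - s|.
  rewrite !mxE -sumrB (le_trans (ler_norm_sum _ _ _))//.
  apply: (@le_trans _ _ (\sum_i `|G j i| * (M * `|t - s|))).
    by apply: ler_sum => i _; rewrite -mulrBr normrM ler_wpM2l.
  rewrite -mulr_suml /c -mulrA ler_wpM2r ?mulr_ge0// (bigD1 j)//= lerDl.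
  by rewrite sumr_ge0// => i _; rewrite sumr_ge0.
have W0 : W 0 = 0 by rewrite /W U0 mulmx0.
have cW j : continuous (fun t => W t j 0).
  apply: (@dominated_continuous _ 'I_1 (fun=> id) c) => //.
    by move=> _ t; exact: cvg_id.
  by move=> s t; rewrite big_ord1.
have WM j t : 0 <= t -> `|W t j 0| <= c * t.
  by move=> t0; have := Wlip j 0 t; rewrite W0 subr0 (ger0_norm t0) [X in _ - X]mxE subr0.
have [Y [Y0 cY dY]] := picard_existence x0 L0 PhiL cW c0 WM.
(* The derivative of [Y] is thus [Phi (X t)], and that of [W] restores [G *m u t]. *)
pose X t := Y t + W t.
have XE t i : X t i 0 = Y t i 0 + W t i 0 by rewrite /X mxE.
have cX j : continuous (fun t => Phi (X t) j 0).
  apply: (@dominated_continuous _ 'I_k (fun j t => X t j 0) L) => //.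
  move=> i t; rewrite (_ : (fun t => _) = (fun t => Y t i 0 + W t i 0)).
    by apply: cvgD; [exact: cY|exact: cW].
  by apply/funext => s; rewrite XE.
exists X; last by rewrite /X Y0 W0 addr0.
split=> [i T T0|].
  have [K K0 HK] := derivable_lipschitz T (cY i) (cX i) (dY i).
  apply: (@abs_continuous_lipschitz _ (K + c)); first exact: addr_ge0.
  move=> x y hx hy; rewrite !XE opprD addrACA (le_trans (ler_normD _ _))// mulrDl.
  by rewrite lerD// HK.
apply: (@filterS _ _ (ae_filter_ringOfSetsType _) _ _ _ dU) => t H t0 i.
rewrite (_ : (fun s => X s i 0) =
    (fun s => Y s i 0) + \sum_j (fun s => G i j *: (U s j 0 : R^o))); last first.
  by apply/funext => s; rewrite !mxE /GRing.add/= fct_sumE.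
rewrite !mxE; apply: is_deriveD; first exact: dY.
by apply: is_derive_sum => j; apply: is_deriveZ; exact: H.
Qed.

End Existence.

(** * The interval predictor *)

Section Parts.
Context {R : realType}.

Definition mxsum {k l} (M : 'M[R]_(k, l)) : R := \sum_i \sum_j `|M i j|.

Lemma mxsum_ge0 k l (M : 'M[R]_(k, l)) : 0 <= mxsum M.
Proof. by rewrite sumr_ge0// => i _; rewrite sumr_ge0. Qed.

Lemma entry_le_mxsum k l (M : 'M[R]_(k, l)) i j : `|M i j| <= mxsum M.
Proof.
rewrite /mxsum (bigD1 i)//= (bigD1 j)//= -addrA lerDl addr_ge0//.
  by rewrite sumr_ge0.
by rewrite sumr_ge0// => ? _; rewrite sumr_ge0.
Qed.

Lemma norm_mulmx_le k l (M : 'M[R]_(k, l)) (v : 'cV[R]_l) i :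
  `|(M *m v) i 0| <= mxsum M * \sum_j `|v j 0|.
Proof.
rewrite mxE (le_trans (ler_norm_sum _ _ _))// mulr_sumr ler_sum// => j _.
by rewrite normrM ler_wpM2r// entry_le_mxsum.
Qed.

Lemma mxposE k l (M : 'M[R]_(k, l)) i j : mxpos M i j = Num.max 0 (M i j).
Proof. by rewrite mxE. Qed.

Lemma max0B (x : R) : Num.max 0 x - x = Num.max 0 (- x).
Proof. by case: (leP 0 x) => h; case: (leP 0 (- x)) => h'; lra. Qed.

Lemma mxnegE k l (M : 'M[R]_(k, l)) i j : mxneg M i j = Num.max 0 (- M i j).
Proof. by rewrite 3!mxE -max0B. Qed.

Lemma mxpos_col k l m (M : 'M[R]_(k, m)) (M' : 'M[R]_(l, m)) :
  mxpos (col_mx M M') = col_mx (mxpos M) (mxpos M').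
Proof. exact: map_col_mx. Qed.

Lemma mxneg_col k l m (M : 'M[R]_(k, m)) (M' : 'M[R]_(l, m)) :
  mxneg (col_mx M M') = col_mx (mxneg M) (mxneg M').
Proof. by rewrite /mxneg mxpos_col opp_col_mx add_col_mx. Qed.

Lemma max0N_lipschitz (x y : R) :
  `|Num.max 0 (- y) - Num.max 0 (- x)| <= `|y - x|.
Proof. by rewrite (le_trans (max0_lipschitz _ _))// -opprD normrN. Qed.

End Parts.

(** * Comparison of the predictor with the true dynamics *)

Section Predictor.
Context {R : realType} {n m : nat}.
Context (A0 DAp DAm : 'M[R]_n) (B : 'M[R]_(n, m)).

Definition calA : 'M[R]_(n + n) := block_mx A0 0 0 A0.
Definition Rplus : 'M[R]_(n + n) := block_mx 0 (- DAm) 0 DAp.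
Definition Rminus : 'M[R]_(n + n) := block_mx DAp 0 (- DAm) 0.
Definition calB : 'M[R]_(n + n, m + m) :=
  block_mx (mxpos B) (- mxneg B) (- mxneg B) (mxpos B).

(** The block signs of [Rminus] require the argument [- mxneg X], which is also half the derivative
    of the squared negative part; this makes the third block of [Upsilon] fit. *)
Definition drift (X : 'cV[R]_(n + n)) : 'cV[R]_(n + n) :=
  calA *m X + Rplus *m mxpos X + Rminus *m (- mxneg X).

Lemma predictorE X D : predictor A0 DAp DAm B X D = drift X + calB *m D.
Proof.
rewrite /predictor /drift -[in RHS](vsubmxK X) -[in RHS](vsubmxK D).
rewrite mxpos_col mxneg_col opp_col_mx /calA /Rplus /Rminus /calB.
rewrite !mul_block_col !mul0mx !add0r !addr0 !add_col_mx !mulNmx !mulmxN opprK.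
congr col_mx; rewrite -!addrA; congr (_ + _).
  by rewrite addrCA.
by rewrite addrA [RHS]addrA; congr (_ + _); exact: addrC.
Qed.

Lemma drift_lipschitz : exists2 L : R, 0 <= L & forall v w i,
  `|drift v i 0 - drift w i 0| <= L * \sum_j `|v j 0 - w j 0|.
Proof.
exists (mxsum calA + mxsum Rplus + mxsum Rminus).
  by rewrite !addr_ge0// mxsum_ge0.
move=> v w i.
have -> : drift v i 0 - drift w i 0 = (calA *m (v - w)) i 0 +
   (Rplus *m (mxpos v - mxpos w)) i 0 - (Rminus *m (mxneg v - mxneg w)) i 0.
  rewrite (mulmxBr calA) (mulmxBr Rplus) (mulmxBr Rminus (mxneg v)).
  rewrite /drift !mulmxN; move: (calA *m v) (calA *m w)
    (Rplus *m mxpos v) (Rplus *m mxpos w) (Rminus *m mxneg v) (Rminus *m mxneg w).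
  move=> a b c d e f; rewrite !mxE; ring.
have le_term (M : 'M[R]_(n + n)) (z : 'cV[R]_(n + n)) :
    (forall j, `|z j 0| <= `|v j 0 - w j 0|) ->
    `|(M *m z) i 0| <= mxsum M * \sum_j `|v j 0 - w j 0|.
  move=> H; rewrite (le_trans (norm_mulmx_le _ _ _))// ler_wpM2l ?mxsum_ge0//.
  exact: ler_sum.
rewrite !mulrDl (le_trans (ler_normB _ _))// lerD//.
  rewrite (le_trans (ler_normD _ _))// lerD// le_term// => j.
    by rewrite !mxE.
  by rewrite !mxE max0_lipschitz.
by apply: le_term => j; rewrite [X in `|X|]mxE [X in _ + X]mxE !mxnegE max0N_lipschitz.
Qed.

(* Reduces the upper bound to the lower one. *)
Lemma predictorN (xl xu : 'cV[R]_n) (dl du : 'cV[R]_m) :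
  dsubmx (predictor A0 DAp DAm B (col_mx xl xu) (col_mx dl du)) =
  - usubmx (predictor A0 DAp DAm B (col_mx (- xu) (- xl)) (col_mx (- du) (- dl))).
Proof.
have posN (k : nat) (v : 'cV[R]_k) : mxpos (- v) = mxneg v.
  by apply/matrixP => i j; rewrite mxposE mxnegE mxE.
have negN (k : nat) (v : 'cV[R]_k) : mxneg (- v) = mxpos v.
  by apply/matrixP => i j; rewrite mxposE mxnegE mxE opprK.
rewrite /predictor !col_mxKu !col_mxKd posN negN.
rewrite !mulmxN !opprD !opprK; do !congr (_ + _).
Qed.

(** One column of the error equation, with [a], [c], [p], [q] entries of [A0], [M], [DAp], [DAm].
    The disjunction is what the Metzler property provides: off the diagonal [a] is nonnegative, on
    it the error is negative; either way [a * (x - xl)] is at least minus [|a|] times the violation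
    [(xl - x)^+]. The uncertain term is at least [- q x^+ - p x^-], and passing from the parts of
    [x] to those of its bounds costs at most the violations. *)
Lemma comparison_term (a p q c x xl xu : R) : 0 <= p -> 0 <= q ->
  - q <= c <= p -> (0 <= a) || (x - xl < 0) ->
  - (`|a| + p + q) * (Num.max 0 (xl - x) + Num.max 0 (x - xu)) <=
  a * (x - xl) + c * x + p * Num.max 0 (- xl) + q * Num.max 0 xu.
Proof.
move=> p0 q0 /andP[qc cp] ax.
have e0 : 0 <= Num.max 0 (xl - x) by rewrite le_max lexx.
have f0 : 0 <= Num.max 0 (x - xu) by rewrite le_max lexx.
have H1 : - `|a| * Num.max 0 (xl - x) <= a * (x - xl).
  have [xlx|xxl] := leP xl x.
    have -> : Num.max 0 (xl - x) = 0 by apply/max_idPl; lra.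
    rewrite mulr0 mulr_ge0 ?subr_ge0//.
    by case/orP: ax => //; rewrite subr_lt0 ltNge xlx.
  have -> : Num.max 0 (xl - x) = xl - x by apply/max_idPr; lra.
  have := ler_norm a; move: xxl; nra.
have H2 : - q * Num.max 0 x - p * Num.max 0 (- x) <= c * x.
  case: (leP 0 x) => h; case: (leP 0 (- x)) => h'; nra.
have H3 : Num.max 0 (- x) - Num.max 0 (- xl) <= Num.max 0 (xl - x).
  by case: (leP 0 (- x)) => h; case: (leP 0 (- xl)) => h'; case: (leP 0 (xl - x)) => h''; lra.
have H4 : Num.max 0 x - Num.max 0 xu <= Num.max 0 (x - xu).
  by case: (leP 0 x) => h; case: (leP 0 xu) => h'; case: (leP 0 (x - xu)) => h''; lra.
have H5 := ler_wpM2l p0 H3; have H6 := ler_wpM2l q0 H4.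
have := mulr_ge0 (normr_ge0 a) f0; have := mulr_ge0 p0 f0; have := mulr_ge0 q0 e0.
lra.
Qed.

(** Sum of [comparison_term] over the columns; the input terms [mxpos B *m (d - dl)] and
    [mxneg B *m (du - d)] are nonnegative and are dropped. *)
Lemma comparison (M : 'M[R]_n) (x xl xu : 'cV[R]_n) (d dl du : 'cV[R]_m) i :
  Metzler A0 -> (forall i j, 0 <= DAp i j) -> (forall i j, 0 <= DAm i j) ->
  (forall i j, - DAm i j <= M i j <= DAp i j) ->
  mxle dl d -> mxle d du -> x i 0 - xl i 0 < 0 ->
  - (mxsum A0 + mxsum DAp + mxsum DAm) *
    (\sum_j (Num.max 0 (xl j 0 - x j 0) + Num.max 0 (x j 0 - xu j 0))) <=
  ((A0 + M) *m x + B *m d) i 0 -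
  usubmx (predictor A0 DAp DAm B (col_mx xl xu) (col_mx dl du)) i 0.
Proof.
move=> mA0 DAp0 DAm0 MDA dld ddu ei.
rewrite /predictor !col_mxKu !col_mxKd.
have -> : ((A0 + M) *m x + B *m d) i 0 - (A0 *m xl - DAp *m mxneg xl -
      DAm *m mxpos xu + mxpos B *m dl - mxneg B *m du) i 0 =
  \sum_j (A0 i j * (x j 0 - xl j 0) + M i j * x j 0 +
     DAp i j * Num.max 0 (- xl j 0) + DAm i j * Num.max 0 (xu j 0)) +
  \sum_j (mxpos B i j * (d j 0 - dl j 0) + mxneg B i j * (du j 0 - d j 0)).
  rewrite mulmxDl.
  have -> : B *m d = mxpos B *m d - mxneg B *m d.
    by rewrite -mulmxBl /mxneg opprB addrC subrK.
  rewrite !big_split/=.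
  rewrite (eq_bigr (fun j => A0 i j * x j 0 - A0 i j * xl j 0)); last by move=> j _; rewrite mulrBr.
  rewrite [X in _ = _ + (X + _)](eq_bigr (fun j => mxpos B i j * d j 0 - mxpos B i j * dl j 0));
    last by move=> j _; rewrite mulrBr.
  rewrite [X in _ = _ + (_ + X)](eq_bigr (fun j => mxneg B i j * du j 0 - mxneg B i j * d j 0));
    last by move=> j _; rewrite mulrBr.
  rewrite !sumrB.
  have mE k l (N : 'M[R]_(k, l)) (v : 'cV[R]_l) (h : 'I_k) : \sum_j N h j * v j 0 = (N *m v) h 0.
    by rewrite mxE.
  have -> : \sum_j DAp i j * Num.max 0 (- xl j 0) = (DAp *m mxneg xl) i 0.
    by rewrite mxE; apply: eq_bigr => j _; rewrite mxnegE.
  have -> : \sum_j DAm i j * Num.max 0 (xu j 0) = (DAm *m mxpos xu) i 0.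
    by rewrite mxE; apply: eq_bigr => j _; rewrite mxposE.
  rewrite !mE.
  move: (A0 *m x) (M *m x) (mxpos B *m d) (mxneg B *m d) (A0 *m xl)
    (DAp *m mxneg xl) (DAm *m mxpos xu) (mxpos B *m dl) (mxneg B *m du) => a b c e f g h k l.
  by rewrite !mxE; ring.
rewrite -[leLHS]addr0 lerD//; last first.
  apply: sumr_ge0 => j _; rewrite mxposE mxnegE.
  by rewrite addr_ge0// mulr_ge0// ?le_max ?lexx// subr_ge0; [exact: dld|exact: ddu].
rewrite mulr_sumr; apply: ler_sum => j _.
have le_K : `|A0 i j| + DAp i j + DAm i j <= mxsum A0 + mxsum DAp + mxsum DAm.
  rewrite lerD//; last by rewrite (le_trans (ler_norm _))// entry_le_mxsum.
  by rewrite lerD ?entry_le_mxsum// (le_trans (ler_norm _))// entry_le_mxsum.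
apply: (le_trans _ (comparison_term _ (DAp0 i j) (DAm0 i j) (MDA i j) _)); last first.
  by have [<-|ij] := eqVneq i j; [rewrite ei orbT|rewrite mA0].
by rewrite !mulNr lerN2 ler_wpM2r// addr_ge0// le_max lexx.
Qed.

End Predictor.

(** * Dissipation and stability *)

Section BilinearForms.
Context {R : realType}.

Definition bil k l (a : 'cV[R]_k) (M : 'M[R]_(k, l)) (b : 'cV[R]_l) : R :=
  (a^T *m M *m b) 0 0.

Lemma bilD k l a (M N : 'M[R]_(k, l)) b : bil a (M + N) b = bil a M b + bil a N b.
Proof. by rewrite /bil mulmxDr mulmxDl mxE. Qed.

Lemma bilN k l a (M : 'M[R]_(k, l)) b : bil a (- M) b = - bil a M b.
Proof. by rewrite /bil mulmxN mulNmx mxE. Qed.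

Lemma bilDr k l a (M : 'M[R]_(k, l)) b c : bil a M (b + c) = bil a M b + bil a M c.
Proof. by rewrite /bil mulmxDr mxE. Qed.

Lemma bil_mulmx k l m a (M : 'M[R]_(k, l)) (N : 'M[R]_(l, m)) b :
  bil a (M *m N) b = bil a M (N *m b).
Proof. by rewrite /bil !mulmxA. Qed.

Lemma bil_trmx k l a (M : 'M[R]_(k, l)) b : bil b M^T a = bil a M b.
Proof.
have tr11 (N : 'M[R]_1) : N^T 0 0 = N 0 0 by rewrite mxE.
by rewrite /bil -[RHS]tr11 !trmx_mul trmxK mulmxA.
Qed.

Lemma bil_diag k (a b : 'cV[R]_k) (M : 'M[R]_k) : is_diag_mx M ->
  bil a M b = \sum_i M i i * a i 0 * b i 0.
Proof.
move=> /is_diag_mxP dM; rewrite /bil mxE; apply: eq_bigr => i _; congr (_ * _).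
rewrite mxE (bigD1 i)//= big1 ?addr0 => [|j ji]; first by rewrite mxE mulrC.
by rewrite dM// mulr0.
Qed.

Lemma bil_diagC k (a b : 'cV[R]_k) (M : 'M[R]_k) : is_diag_mx M ->
  bil a M b = bil b M a.
Proof. by move=> dM; rewrite !bil_diag//; apply: eq_bigr => i _; rewrite mulrAC. Qed.

Lemma bil_block k1 k2 l1 l2 (a1 : 'cV[R]_k1) (a2 : 'cV[R]_k2) (b1 : 'cV[R]_l1)
    (b2 : 'cV[R]_l2) M11 M12 M21 M22 :
  bil (col_mx a1 a2) (block_mx M11 M12 M21 M22) (col_mx b1 b2) =
  bil a1 M11 b1 + bil a1 M12 b2 + bil a2 M21 b1 + bil a2 M22 b2.
Proof.
rewrite /bil tr_col_mx mul_row_block mul_row_col !mulmxDl.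
move: (_ *m _) (_ *m _) (_ *m _) (_ *m _) => a b c d.
by rewrite !mxE addrACA !addrA.
Qed.

Lemma bil_mull k (a b : 'cV[R]_k) (M D : 'M[R]_k) : is_diag_mx D ->
  bil a (M^T *m D) b = bil b D (M *m a).
Proof.
by move=> dD; rewrite [RHS]bil_diagC// /bil trmx_mul !mulmxA.
Qed.

(** Each off-diagonal block occurs twice, and the terms with [P], [Zp], [Zm] recombine into twice
    their pairing with the vector field [D]. Diagonality lets these matrices move across the
    form. *)
Lemma Upsilon_form k (A Rp Rm P Q Qp Qm Zp Zm Psip Psim Psi Gamma : 'M[R]_k)
    (Y1 Y2 Y3 w : 'cV[R]_k) :
  is_diag_mx P -> is_diag_mx Q -> is_diag_mx Qp -> is_diag_mx Qm ->
  is_diag_mx Zp -> is_diag_mx Zm -> is_diag_mx Psip -> is_diag_mx Psim ->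
  is_diag_mx Psi -> is_diag_mx Gamma ->
  let D := A *m Y1 + Rp *m Y2 + Rm *m Y3 + w in
  bil (col_mx (col_mx Y1 Y2) (col_mx Y3 w))
    (Upsilon A Rp Rm P Q Qp Qm Zp Zm Psip Psim Psi Gamma)
    (col_mx (col_mx Y1 Y2) (col_mx Y3 w)) =
  \sum_i (2 * (P i i * Y1 i 0 + Zp i i * Y2 i 0 + Zm i i * Y3 i 0) * D i 0 +
    (Q i i * Y1 i 0 ^+ 2 + Qp i i * Y2 i 0 ^+ 2 + Qm i i * Y3 i 0 ^+ 2 +
     2 * Psip i i * Y1 i 0 * Y2 i 0 + 2 * Psim i i * Y1 i 0 * Y3 i 0 +
     2 * Psi i i * Y2 i 0 * Y3 i 0) - Gamma i i * w i 0 ^+ 2).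
Proof.
move=> dP dQ dQp dQm dZp dZm dPsip dPsim dPsi dGamma D.
transitivity (2 * (bil Y1 P D + bil Y2 Zp D + bil Y3 Zm D) +
  (bil Y1 Q Y1 + bil Y2 Qp Y2 + bil Y3 Qm Y3 + 2 * bil Y1 Psip Y2 +
   2 * bil Y1 Psim Y3 + 2 * bil Y2 Psi Y3) - bil w Gamma w); last first.
  rewrite !bil_diag// !mulrDr !mulr_sumr -!big_split -sumrB /=.
  by apply: eq_bigr => i _; ring.
rewrite /Upsilon !bil_block !bil_trmx !bilD !bilN !bil_mull// !bil_mulmx.
rewrite /D !bilDr (bil_diagC w Y1)// (bil_diagC w Y2)// (bil_diagC w Y3)//.
ring.
Qed.

End BilinearForms.

(** * Quadratic Lyapunov functions and input-to-state stability *)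

Section Stability.
Context {R : realType}.
Notation mu := (@lebesgue_measure R).

Lemma finite_pos_lower_bound k (f : 'I_k -> R) : (forall i, 0 < f i) ->
  exists2 c, 0 < c & forall i, c <= f i.
Proof.
move=> f0; exists (\big[Num.min/1]_i f i); first by apply: lt_bigmin.
by move=> i; exact: bigmin_le_cond.
Qed.

Lemma sqr_norm (x : R) : `|x| ^+ 2 = x ^+ 2.
Proof. by rewrite real_normK// num_real. Qed.

(** At most one part of [x] is nonzero, and its square is then [x ^+ 2]: the total coefficient is
    [p + q] or [p + r], according to the sign of [x]. *)
Lemma wsq_ge (p q r v x : R) : v <= p + Num.min q r -> v * x ^+ 2 <= wsq p q r x.
Proof.
move=> h; have x2 := sqr_ge0 x.
have hq : v <= p + q by rewrite (le_trans h)// lerD2l ge_min lexx.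
have hr : v <= p + r by rewrite (le_trans h)// lerD2l ge_min lexx orbT.
rewrite /wsq; have [x0|x0] := leP 0 x.
  have -> : Num.max 0 (- x) = 0 by apply/max_idPl; lra.
  have := ler_wpM2r x2 hq; lra.
have -> : Num.max 0 (- x) = - x by apply/max_idPr; lra.
have := ler_wpM2r x2 hr; rewrite sqrrN; lra.
Qed.

Lemma wsq_le (p q r x : R) : wsq p q r x <= (`|p| + `|q| + `|r|) * x ^+ 2.
Proof.
have H (y : R) : Num.max 0 y ^+ 2 <= y ^+ 2.
  by rewrite -(sqr_norm (Num.max 0 y)) -(sqr_norm y) ler_sqr ?nnegrE// norm_max0.
rewrite /wsq !mulrDl !lerD//.
- by rewrite ler_wpM2r ?sqr_ge0// ler_norm.
- by rewrite (le_trans (ler_wpM2r (sqr_ge0 _) (ler_norm q)))// ler_wpM2l.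
- rewrite (le_trans (ler_wpM2r (sqr_ge0 _) (ler_norm r)))// ler_wpM2l//.
  by rewrite (le_trans (H _))// sqrrN.
Qed.

(** Origin of the last condition in (ii): [x x^+] and [- x x^-] are the squares of the parts, so
    [pp] and [pm], which occur twice, add to the coefficient of [x ^+ 2], while [x^+ x^- = 0]
    cancels the [ps] term whatever its sign. *)
Lemma wsq_supply (q qp qm pp pm ps c x : R) :
  c <= q + Num.min qp qm + 2 * Num.min pp pm ->
  c * x ^+ 2 <= q * x ^+ 2 + qp * Num.max 0 x ^+ 2 + qm * (- Num.max 0 (- x)) ^+ 2 +
    2 * pp * x * Num.max 0 x + 2 * pm * x * - Num.max 0 (- x) +
    2 * ps * Num.max 0 x * - Num.max 0 (- x).
Proof.
move=> h; have x2 := sqr_ge0 x.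
have hp : c <= q + qp + 2 * pp.
  rewrite (le_trans h)// lerD ?ler_wpM2l// ?ge_min ?lexx//.
  by rewrite lerD2l ge_min lexx.
have hm : c <= q + qm + 2 * pm.
  rewrite (le_trans h)// lerD ?ler_wpM2l// ?ge_min ?lexx ?orbT//.
  by rewrite lerD2l ge_min lexx orbT.
have [x0|x0] := leP 0 x.
  have -> : Num.max 0 (- x) = 0 by apply/max_idPl; lra.
  have := ler_wpM2r x2 hp; lra.
have -> : Num.max 0 (- x) = - x by apply/max_idPr; lra.
have := ler_wpM2r x2 hm; lra.
Qed.

(** Bounding the [Q] and [Psi] terms of the form from below by [wsq_supply] leaves a decay rate [c]
    common to all coordinates. *)
Lemma dissipation k (A Rp Rm P Q Qp Qm Zp Zm Psip Psim Psi Gamma : 'M[R]_k) (c : R)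
    (X w : 'cV[R]_k) :
  is_diag_mx P -> is_diag_mx Q -> is_diag_mx Qp -> is_diag_mx Qm ->
  is_diag_mx Zp -> is_diag_mx Zm -> is_diag_mx Psip -> is_diag_mx Psim ->
  is_diag_mx Psi -> is_diag_mx Gamma ->
  neg_semidef (Upsilon A Rp Rm P Q Qp Qm Zp Zm Psip Psim Psi Gamma) ->
  (forall i, c <= (Q + mxmin Qp Qm + 2%:R *: mxmin Psip Psim) i i) ->
  \sum_i dwsq (P i i) (Zp i i) (Zm i i) (X i 0) *
    (A *m X + Rp *m mxpos X + Rm *m (- mxneg X) + w) i 0 <=
  - c * \sum_i X i 0 ^+ 2 + \sum_i Gamma i i * w i 0 ^+ 2.
Proof.
move=> dP dQ dQp dQm dZp dZm dPsip dPsim dPsi dGamma nsd cQ.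
have := nsd (col_mx (col_mx X (mxpos X)) (col_mx (- mxneg X) w)).
rewrite -/(bil _ _ _) Upsilon_form// => H.
rewrite -subr_le0; apply: le_trans H.
rewrite mulr_sumr -big_split -sumrB /=; apply: ler_sum => i _.
set D := (_ + w); rewrite [(- mxneg X) i 0]mxE mxposE mxnegE.
have := @wsq_supply (Q i i) (Qp i i) (Qm i i) (Psip i i) (Psim i i) (Psi i i) c (X i 0).
have := cQ i; rewrite [X in _ <= X -> _]mxE [X in _ <= X + _ -> _]mxE.
rewrite [X in _ <= _ + X + _ -> _]mxE [X in _ <= _ + _ + X -> _]mxE.
rewrite [X in _ <= _ + _ + _ * X -> _]mxE => cQi /(_ cQi).
rewrite /dwsq; move: (D i 0) => Di; lra.
Qed.

Lemma class_KL_exp (k c : R) : 0 < k -> 0 < c ->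
  class_KL (fun s t => k * s * expR (- c * t)).
Proof.
move=> k0 c0; split.
- apply: continuous_subspaceT => p.
  apply: (@cvgM _ _ _ _ (fun p : R * R => k * p.1) (fun p : R * R => expR (- c * p.2))).
    by apply: cvgM; [exact: cvg_cst|exact: cvg_fst].
  apply: (@cvg_comp _ _ _ (fun p : R * R => - c * p.2) expR); last exact: continuous_expR.
  by apply: cvgM; [exact: cvg_cst|exact: cvg_snd].
- move=> t t0; split.
  + apply: continuous_subspaceT => s.
    by apply: cvgM; [apply: cvgM; [exact: cvg_cst|exact: cvg_id]|exact: cvg_cst].
  + by move=> x y _ xy; rewrite ltr_pM2r ?expR_gt0// ltr_pM2l.
  + by rewrite mulr0 mul0r.
- move=> s t t' s0 t0 tt'; apply: ler_wpM2l; first by rewrite mulr_ge0// ltW.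
  by rewrite ler_expR !mulNr lerN2 ler_wpM2l// ltW.
- move=> s s0; rewrite -(mulr0 (k * s)); apply: cvgM; first exact: cvg_cst.
  apply/cvgrPdist_lt => e e0.
  (* Beyond this time [c * t > 1 / e], and [expR (c * t) >= 1 + c * t] then exceeds [1 / e]. *)
  exists (1 / (c * e)); split; first by rewrite num_real.
  move=> t /= te; rewrite sub0r normrN ger0_norm ?expR_ge0//.
  have ce0 : 0 < c * e by rewrite mulr_gt0.
  have ct : 1 < c * t * e by move: te; rewrite ltr_pdivrMr// mulrA (mulrC t).
  rewrite mulNr expRN -[ltRHS]invrK ltf_pV2 ?posrE ?expR_gt0 ?invr_gt0//.
  apply: (lt_le_trans _ (expR_ge1Dx _)).
  rewrite ltr_wpDl// -[e^-1]mul1r ltr_pdivrMr//.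
Qed.

Lemma class_K_linear (k : R) : 0 < k -> class_K (fun s => k * s).
Proof.
move=> k0; split.
- by apply: continuous_subspaceT => s; apply: cvgM; [exact: cvg_cst|exact: cvg_id].
- by move=> x y _ xy; rewrite ltr_pM2l.
- by rewrite mulr0.
Qed.

Lemma abs_continuous_subset (a b b' : R) (f : R -> R) : b <= b' ->
  abs_continuous a b' f -> abs_continuous a b f.
Proof.
move=> bb' acf e /acf[d d0 H]; exists d => // k l u lu.
apply: H => i; have [? ? ub] := lu i; split => //; exact: le_trans bb'.
Qed.

(** As V lies between [v1] and [v2] times the squared norm, dissipation becomes
    [V' <= - (c / v2) V + g1 |u|^2]; returning from squared norms to norms halves the rate, whence
    [a / 2] in the exponential. *)
Lemma quadratic_iss k l (Phi : 'cV[R]_k -> 'cV[R]_k) (G : 'M[R]_(k, l))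
    (p q r g : 'I_k -> R) (c : R) :
  (exists2 L, 0 <= L & forall v w i,
    `|Phi v i 0 - Phi w i 0| <= L * \sum_j `|v j 0 - w j 0|) ->
  (forall i, 0 < p i + Num.min (q i) (r i)) -> 0 < c -> (forall i, 0 <= g i) ->
  (forall X w : 'cV[R]_k,
    \sum_i dwsq (p i) (q i) (r i) (X i 0) * (Phi X + w) i 0 <=
    - c * \sum_i X i 0 ^+ 2 + \sum_i g i * w i 0 ^+ 2) ->
  input_to_state_stable (fun v u => Phi v + G *m u).
Proof.
move=> [L L0 PhiL] pqr c0 g0 diss.
have [v1 v10 Hv1] := finite_pos_lower_bound pqr.
pose v2 := \sum_i (`|p i| + `|q i| + `|r i|) + 1.
have v20 : 0 < v2 by rewrite ltr_wpDl// sumr_ge0// => i _; rewrite !addr_ge0.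
pose a := c / v2; have a0 : 0 < a by rewrite divr_gt0.
pose g1 := (\sum_i g i) * mxsum G ^+ 2.
have g10 : 0 <= g1 by rewrite mulr_ge0 ?sqr_ge0// sumr_ge0.
(* Since [y <= (y + 1) ^+ 2] for [y >= 0], adding 1 to the gains replaces taking square roots; it
   also keeps them positive, as strict monotonicity requires. *)
pose k1 := v2 / v1 + 1; have k10 : 0 < k1 by rewrite ltr_wpDl// divr_ge0// ltW.
pose k2 := g1 / (a * v1) + 1.
have k20 : 0 < k2 by rewrite ltr_wpDl// divr_ge0// ltW// mulr_gt0.
exists (fun s t => k1 * s * expR (- (a / 2) * t)), (fun s => k2 * s); split.
- by apply: class_KL_exp => //; rewrite divr_gt0.
- exact: class_K_linear.
move=> X0 u uL; split.
  exact: (solution_exists G X0 L0 PhiL uL).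
move=> X [acX dX] X0E T T0.
set s := fine _.
have s0 : 0 <= s by rewrite fine_ge0// ess_norm_ge0.
have us : {ae mu, forall t, `[0, T[%classic t -> enorm (u t) <= s}.
  apply: enorm_le_ess_norm; have [_] := uL; apply: le_lt_trans.
  by apply: le_ess_norm => t; rewrite /= !in_itv/= => /andP[->].
pose V := wsqn p q r.
have VX x : v1 * enorm x ^+ 2 <= V x.
  by rewrite sqr_enorm mulr_sumr; apply: ler_sum => i _; exact: wsq_ge.
have Vle x : V x <= v2 * enorm x ^+ 2.
  rewrite sqr_enorm mulr_sumr; apply: ler_sum => i _.
  rewrite (le_trans (wsq_le _ _ _ _))// ler_wpM2r ?sqr_ge0//.
  rewrite /v2 (bigD1 i)//= -[leRHS]addrA lerDl addr_ge0// sumr_ge0//.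
(* [is_solution] speaks of positive horizons, and [T] may be 0: hence the detour through [T + 1]. *)
have acXT : forall j, abs_continuous 0 T (fun t => X t j 0).
  move=> j.
  by apply: (@abs_continuous_subset 0 T (T + 1)); [rewrite lerDl|apply: acX; rewrite ltr_wpDl].
have gron : V (X T) <= expR (- a * T) * (V (X 0) + g1 * s ^+ 2 / - a) - g1 * s ^+ 2 / - a.
  apply: (@abs_continuous_gronwall _ (- a) (g1 * s ^+ 2) T (fun t => V (X t))) => //.
  - by rewrite oppr_eq0 gt_eqF.
  - exact: abs_continuous_wsqn.
  apply: (@filterS2 _ _ (ae_filter_ringOfSetsType _) _ _ _ _ dX us) => t dXt ut /andP[t0 tT].
  exists (\sum_i dwsq (p i) (q i) (r i) (X t i 0) * (Phi (X t) + G *m u t) i 0).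
    by apply: is_derive_wsqn => i; exact: dXt.
  rewrite (le_trans (diss _ _))// lerD//.
    rewrite !mulNr lerN2 -sqr_enorm /a mulrAC ler_pdivrMr// -mulrA ler_pM2l//.
    by rewrite mulrC; exact: Vle.
  rewrite /g1 -mulrA mulr_suml; apply: ler_sum => i _; rewrite ler_wpM2l//.
  rewrite -exprMn -[leLHS]sqr_norm ler_sqr ?nnegrE ?mulr_ge0 ?mxsum_ge0//.
  have uts : enorm (u t) <= s by apply: ut; rewrite /= in_itv/= ltW.
  rewrite mxE (le_trans (ler_norm_sum _ _ _))//.
  apply: (@le_trans _ _ (\sum_j `|G i j| * s)).
    apply: ler_sum => j _; rewrite normrM ler_wpM2l//.
    by rewrite (le_trans (entry_le_enorm _ _)).
  rewrite -mulr_suml ler_wpM2r// /mxsum (bigD1 i)//= lerDl sumr_ge0// => j _.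
  by rewrite sumr_ge0.
set E := expR (- (a / 2) * T).
have EE : expR (- a * T) = E ^+ 2.
  by rewrite /E expr2 -expRD; congr expR; field.
have E0 : 0 <= E by exact: expR_ge0.
have E1 : E ^+ 2 <= 1.
  by rewrite -EE -expR0 ler_expR mulNr oppr_le0 mulr_ge0// ltW.
have k1le : v2 / v1 <= k1 ^+ 2.
  have : 0 <= v2 / v1 by rewrite divr_ge0// ltW.
  rewrite /k1; nra.
have k2le : g1 / (a * v1) <= k2 ^+ 2.
  have : 0 <= g1 / (a * v1) by rewrite divr_ge0// ltW// mulr_gt0.
  rewrite /k2; nra.
have main : enorm (X T) ^+ 2 <= (v2 / v1) * (E * enorm X0) ^+ 2 + g1 / (a * v1) * s ^+ 2.
  rewrite -(ler_pM2l v10) (le_trans (VX _))// (le_trans gron)// EE X0E.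
  have -> : v1 * (v2 / v1 * (E * enorm X0) ^+ 2 + g1 / (a * v1) * s ^+ 2) =
      E ^+ 2 * (v2 * enorm X0 ^+ 2) + g1 * s ^+ 2 / a.
    by field; rewrite !gt_eqF.
  rewrite invrN mulrN opprK mulrBr.
  have b0 : 0 <= g1 * s ^+ 2 / a by apply: divr_ge0; [rewrite mulr_ge0 ?sqr_ge0|exact: ltW].
  have := ler_wpM2l (sqr_ge0 E) (Vle X0).
  have := mulr_ge0 (sqr_ge0 E) b0; lra.
have R0 : 0 <= k1 * enorm X0 * E by rewrite !mulr_ge0 ?enorm_ge0// ltW.
have S0 : 0 <= k2 * s by rewrite mulr_ge0// ltW.
(* After squaring, the nonnegative cross term on the right is discarded. *)
rewrite -ler_sqr ?nnegrE ?enorm_ge0 ?addr_ge0// (le_trans main)//.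
have := ler_wpM2r (sqr_ge0 (E * enorm X0)) k1le.
have := ler_wpM2r (sqr_ge0 s) k2le.
have := mulr_ge0 R0 S0.
lra.
Qed.

End Stability.

(** * Interval bounds *)

Section IntervalBounds.
Context {R : realType}.
Notation mu := (@lebesgue_measure R).

Lemma enorm_col_mx k l (v : 'cV[R]_k) (w : 'cV[R]_l) :
  enorm (col_mx v w) <= enorm v + enorm w.
Proof.
have ve := enorm_ge0 v; have we := enorm_ge0 w.
rewrite -ler_sqr ?nnegrE ?enorm_ge0 ?addr_ge0// sqrrD !sqr_enorm big_split_ord/=.
under eq_bigr do rewrite col_mxEu.
under [X in _ + X <= _]eq_bigr do rewrite col_mxEd.
by have := mulr_ge0 ve we; lra.
Qed.

Lemma Linfty_col_mx k l (u : R -> 'cV[R]_k) (v : R -> 'cV[R]_l) :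
  Linfty u -> Linfty v -> Linfty (fun t => col_mx (u t) (v t)).
Proof.
move=> [mu_ uoo] [mv voo]; split=> [i|].
  case: (split_ordP i) => j ->.
    rewrite (_ : (fun t => _) = (fun t => u t j 0)); first exact: mu_.
    by apply/funext => t; rewrite col_mxEu.
  rewrite (_ : (fun t => _) = (fun t => v t j 0)); first exact: mv.
  by apply/funext => t; rewrite col_mxEd.
pose Mu := fine (ess_norm `[0, +oo[ u); pose Mv := fine (ess_norm `[0, +oo[ v).
have Mu0 : 0 <= Mu by rewrite fine_ge0// ess_norm_ge0.
have Mv0 : 0 <= Mv by rewrite fine_ge0// ess_norm_ge0.
apply: (@le_lt_trans _ _ (Mu + Mv)%:E); last exact: ltry.
apply/ess_supP; apply: (@filterS2 _ _ (ae_filter_ringOfSetsType _) _ _ _ _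
  (enorm_le_ess_norm uoo) (enorm_le_ess_norm voo)) => t ut vt.
rewrite lee_fin; case: ifPn => [|_]; last exact: addr_ge0.
rewrite inE => Dt; rewrite (le_trans (enorm_col_mx _ _))// lerD//; [exact: ut|exact: vt].
Qed.

(** Entrywise, a weight in [[0, 1]] places [c * a] between [- a^-] and [a^+]. *)
Lemma convex_sum_bounds (N k l : nat) (DA : 'I_N -> 'M[R]_(k, l)) (c : 'I_N -> R) i j :
  (forall h, 0 <= c h <= 1) ->
  - (\sum_h mxneg (DA h)) i j <= (\sum_h c h *: DA h) i j
    <= (\sum_h mxpos (DA h)) i j.
Proof.
move=> c01; rewrite !summxE -sumrN; apply/andP; split; apply: ler_sum => h _;
  have /andP[c0 c1] := c01 h.
- rewrite mxnegE [leRHS]mxE; set a := DA h i j.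
  by have [a0|a0] := leP 0 (- a); nra.
- rewrite mxposE [leLHS]mxE; set a := DA h i j.
  by have [a0|a0] := leP 0 a; nra.
Qed.

Lemma predictor_bounds (n m : nat) (A0 DAp DAm : 'M[R]_n) (B : 'M[R]_(n, m))
    (M : R -> 'M[R]_n) (x xl xu : R -> 'cV[R]_n) (d dl du : R -> 'cV[R]_m) :
  Metzler A0 -> (forall i j, 0 <= DAp i j) -> (forall i j, 0 <= DAm i j) ->
  (forall t, 0 <= t -> forall i j, - DAm i j <= M t i j <= DAp i j) ->
  (forall t, 0 <= t -> mxle (dl t) (d t) /\ mxle (d t) (du t)) ->
  is_solution (fun t v => (A0 + M t) *m v + B *m d t) x ->
  is_solution (fun t v => predictor A0 DAp DAm B v (col_mx (dl t) (du t)))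
    (fun t => col_mx (xl t) (xu t)) ->
  mxle (xl 0) (x 0) -> mxle (x 0) (xu 0) ->
  forall t, 0 <= t -> mxle (xl t) (x t) /\ mxle (x t) (xu t).
Proof.
move=> mA0 DAp0 DAm0 MDA d_bounds [acx dx] [acX dX] xl0 xu0 T T0.
pose E t := col_mx (x t - xl t) (xu t - x t).
have EuE i : (fun s => E s (lshift n i) 0) =
    (fun s => x s i 0) \- (fun s => col_mx (xl s) (xu s) (lshift n i) 0).
  by apply/funext => s; rewrite /E /= !col_mxEu mxE [X in _ + X = _]mxE.
have EdE i : (fun s => E s (rshift n i) 0) =
    (fun s => col_mx (xl s) (xu s) (rshift n i) 0) \- (fun s => x s i 0).
  by apply/funext => s; rewrite /E /= !col_mxEd mxE [X in _ + X = _]mxE.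
have sumE t : \sum_j Num.max 0 (- E t j 0) =
    \sum_j (Num.max 0 (xl t j 0 - x t j 0) + Num.max 0 (x t j 0 - xu t j 0)).
  rewrite big_split_ord/= -big_split/=; apply: eq_bigr => j _.
  have /(congr1 (fun f => f t)) -> := EuE j.
  have /(congr1 (fun f => f t)) -> := EdE j.
  by rewrite /= col_mxEu col_mxEd !opprB.
have T1 : 0 < T + 1 by rewrite ltr_wpDl.
have T1' : T <= T + 1 by rewrite lerDl.
suff H : forall i, 0 <= E T i 0.
  split => i j; rewrite ord1.
    have := H (lshift n i); have /(congr1 (fun f => f T)) -> := EuE i.
    by rewrite /= col_mxEu subr_ge0.
  have := H (rshift n i); have /(congr1 (fun f => f T)) -> := EdE i.
  by rewrite /= col_mxEd subr_ge0.
apply: (@nonneg_invariance _ _ _ (mxsum A0 + mxsum DAp + mxsum DAm)) => //.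
- by rewrite !addr_ge0// mxsum_ge0.
- move=> i; apply: (abs_continuous_subset T1').
  case: (split_ordP i) => j ->; rewrite ?EuE ?EdE.
    by apply: abs_continuousB; [exact: acx|exact: acX].
  by apply: abs_continuousB; [exact: acX|exact: acx].
- move=> i; case: (split_ordP i) => j ->.
    have /(congr1 (fun f => f 0)) -> := EuE j.
    by rewrite /= col_mxEu subr_ge0; exact: xl0.
  have /(congr1 (fun f => f 0)) -> := EdE j.
  by rewrite /= col_mxEd subr_ge0; exact: xu0.
apply: (@filterS2 _ _ (ae_filter_ringOfSetsType _) _ _ _ _ dx dX) => t dxt dXt /andP[t0 _].
have [dld ddu] := d_bounds t (ltW t0).
pose a := (A0 + M t) *m x t + B *m d t.
pose Fv := predictor A0 DAp DAm B (col_mx (xl t) (xu t)) (col_mx (dl t) (du t)).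
exists (fun i => col_mx (a - usubmx Fv) (dsubmx Fv - a) i 0) => i.
rewrite sumE; case: (split_ordP i) => j ->; split.
- rewrite EuE col_mxEu [X in is_derive _ _ _ X]mxE [X in is_derive _ _ _ (_ + X)]mxE.
  apply: is_deriveB; first exact: dxt.
  by rewrite [usubmx Fv j 0]mxE; exact: dXt.
- have /(congr1 (fun f => f t)) -> := EuE j; rewrite /= col_mxEu => Ej.
  rewrite col_mxEu [leRHS]mxE [X in _ <= _ + X]mxE.
  exact: comparison (MDA t (ltW t0)) dld ddu Ej.
- rewrite EdE col_mxEd [X in is_derive _ _ _ X]mxE [X in is_derive _ _ _ (_ + X)]mxE.
  apply: is_deriveB; last exact: dxt.
  by rewrite [dsubmx Fv j 0]mxE; exact: dXt.
- have /(congr1 (fun f => f t)) -> := EdE j; rewrite /= col_mxEd => Ej.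
  rewrite col_mxEd [leRHS]mxE [X in _ <= _ + X]mxE.
  (* By [predictorN] the upper bound is a lower bound for negated data: [comparison] is applied to
     [- x t], with lower bound [- xu t] and upper bound [- xl t]. *)
  have ddu' : mxle (- du t) (- d t) by move=> h h'; rewrite !mxE lerN2; exact: ddu.
  have dld' : mxle (- d t) (- dl t) by move=> h h'; rewrite !mxE lerN2; exact: dld.
  have Ej' : (- x t) j 0 - (- xu t) j 0 < 0 by rewrite !mxE opprK addrC.
  have := comparison B (- xl t) mA0 DAp0 DAm0 (MDA t (ltW t0)) ddu' dld' Ej'.
  rewrite !mulmxN -opprD -/a /Fv predictorN [(- a) j 0]mxE addrC.
  rewrite [X in _ -> _ <= X + _]mxE; apply: le_trans.
  (* Negation has exchanged the two kinds of violation, which leaves their sum unchanged. *)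
  rewrite le_eqVlt; apply/orP; left; apply/eqP; congr (_ * _).
  by apply: eq_bigr => h _; rewrite !mxE addrC; congr (Num.max 0 _ + Num.max 0 _); ring.
Qed.

End IntervalBounds.

Theorem theorem1 (R : realType) (n r m : nat)
  (Pi : set 'cV[R]_r) (A : 'cV[R]_r -> 'M[R]_n) (B : 'M[R]_(n, m))
  (theta : R -> 'cV[R]_r) (d : R -> 'cV[R]_m) (x : R -> 'cV[R]_n)
  (A_cont : {within Pi, continuous A})
  (theta_Linfty : Linfty theta)
  (theta_Pi : forall t, 0 <= t -> Pi (theta t))
  (x_sol : is_solution (fun t v => A (theta t) *m v + B *m d t) x)
  (* (A1) *)
  (x_Linfty : Linfty x)
  (x0l x0u : 'cV[R]_n)
  (x0_bounds : mxle x0l (x 0) /\ mxle (x 0) x0u)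
  (* (A2) *)
  (dl du : R -> 'cV[R]_m)
  (dl_Linfty : Linfty dl) (du_Linfty : Linfty du)
  (d_bounds : forall t, 0 <= t -> mxle (dl t) (d t) /\ mxle (d t) (du t))
  (* (A3) *)
  (A0 : 'M[R]_n) (A0_Metzler : Metzler A0)
  (N : nat) (N_ge1 : (1 <= N)%N)
  (DA : 'I_N -> 'M[R]_n) (lambda : 'I_N -> 'cV[R]_r -> R)
  (lambda_01 : forall i th, Pi th -> 0 <= lambda i th <= 1)
  (A_polytopic : forall th, Pi th ->
     A th = A0 + \sum_i lambda i th *: DA i /\ \sum_i lambda i th = 1) :
  let DAp := \sum_i mxpos (DA i) in
  let DAm := \sum_i mxneg (DA i) in
  let F := predictor A0 DAp DAm B in
  let is_P_solution (xl xu : R -> 'cV[R]_n) :=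
    [/\ is_solution (fun t v => F v (col_mx (dl t) (du t)))
          (fun t => col_mx (xl t) (xu t)),
        xl 0 = x0l & xu 0 = x0u] in
  (* (i) *)
  ((exists xl xu, is_P_solution xl xu) /\
   (forall xl xu, is_P_solution xl xu ->
      forall t, 0 <= t -> mxle (xl t) (x t) /\ mxle (x t) (xu t))) /\
  (* (ii) *)
  ((exists P Q Qp Qm Zp Zm Psip Psim Psi Gamma : 'M[R]_(n + n),
      let calA := block_mx A0 0 0 A0 in
      let Rp := block_mx 0 (- DAm) 0 DAp in
      let Rm := block_mx DAp 0 (- DAm) 0 in
      [/\ [/\ is_diag_mx P, is_diag_mx Q, is_diag_mx Qp, is_diag_mx Qm
            & is_diag_mx Zp],
          [/\ is_diag_mx Zm, is_diag_mx Psip, is_diag_mx Psim, is_diag_mx Psi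
            & is_diag_mx Gamma],
          diag_gt0 (P + mxmin Zp Zm),
          neg_semidef (Upsilon calA Rp Rm P Q Qp Qm Zp Zm Psip Psim Psi Gamma)
        & diag_gt0 Gamma /\
          diag_gt0 (Q + mxmin Qp Qm + 2%:R *: mxmin Psip Psim)]) ->
   input_to_state_stable F).
Proof.
move=> DAp DAm F is_P_solution.
have DAp0 i j : 0 <= DAp i j.
  by rewrite summxE sumr_ge0// => h _; rewrite mxposE le_max lexx.
have DAm0 i j : 0 <= DAm i j.
  by rewrite summxE sumr_ge0// => h _; rewrite mxnegE le_max lexx.
(* Splitting off the linear input term puts [F] in the form required for both existence and
   stability. *)
have FE v w : F v w = drift A0 DAp DAm v + calB B *m w by exact: predictorE.
have [L L0 HL] := drift_lipschitz A0 DAp DAm.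
split; last first.
  move=> [P [Q [Qp [Qm [Zp [Zm [Psip [Psim [Psi [Gamma]]]]]]]]]] /=.
  move=> [[dP dQ dQp dQm dZp] [dZm dPsip dPsim dPsi dGamma] PZ nsd [Gamma0 QPsi]].
  have [c c0 Hc] := finite_pos_lower_bound QPsi.
  have -> : F = fun v w => drift A0 DAp DAm v + calB B *m w.
    by apply/funext => v; apply/funext => w.
  apply: (@quadratic_iss _ _ _ _ _ (fun i => P i i) (fun i => Zp i i)
    (fun i => Zm i i) (fun i => Gamma i i) c) => //.
  - by exists L.
  - by move=> i; have := PZ i; rewrite mxE [X in _ + X]mxE.
  - by move=> i; rewrite ltW.
  - by move=> X w; exact: dissipation nsd Hc.
split.
  have uL := Linfty_col_mx dl_Linfty du_Linfty.
  have [X solX X0] := solution_exists (calB B) (col_mx x0l x0u) L0 HL uL.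
  exists (fun t => usubmx (X t)), (fun t => dsubmx (X t)); split.
  - rewrite (_ : (fun t => col_mx _ _) = X); last by apply/funext => t; rewrite vsubmxK.
    rewrite (_ : (fun t v => _) =
      (fun t v => drift A0 DAp DAm v + calB B *m col_mx (dl t) (du t))) //.
    by apply/funext => t; apply/funext => v; rewrite FE.
  - by rewrite X0 col_mxKu.
  - by rewrite X0 col_mxKd.
move=> xl xu [sol xl0 xu0].
apply: (@predictor_bounds _ _ _ A0 DAp DAm B
  (fun t => \sum_i lambda i (theta t) *: DA i) x xl xu d dl du) => //.
- move=> t t0 i j; apply: convex_sum_bounds => h.
  exact/lambda_01/theta_Pi.
(* At positive times [theta t] lies in [Pi], so (A3) rewrites the matrix in the differential
   equation. *)
- have [acx dx] := x_sol; split => //.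
  apply: (@filterS _ _ (ae_filter_ringOfSetsType _) _ _ _ dx) => t H t0 i.
  by have [AE _] := A_polytopic _ (theta_Pi t (ltW t0)); rewrite -AE; exact: H.
- by rewrite xl0; case: x0_bounds.
- by rewrite xu0; case: x0_bounds.
Qed.
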